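(* There exists a randomized algorithm with the following property. Given a positive integer $k$ and value-oracle access to a non-negative submodular function $f\colon 2^{\mathcal{N}}\to\mathbb{R}$ on a ground set $\mathcal{N}$ of size $n$, the algorithm outputs a set $S\subseteq\mathcal{N}$ with $|S|\le k$ such that $\mathbb{E}[f(S)]\ge 0.385\cdot f(\mathrm{OPT})$, where $\mathrm{OPT}\in\arg\max\{f(T): T\subseteq\mathcal{N},\,|T|\le k\}$, and the algorithm makes $O(n+k^2)$ queries to the value oracle of $f$.
   Context: A set function $f\colon 2^{\mathcal{N}}\to\mathbb{R}$ is submodular if $f(A\cup\{s\})-f(A)\ge f(B\cup\{s\})-f(B)$ for all $A\subseteq B\subseteq\mathcal{N}$ and $s\in\mathcal{N}\setminus B$; it is non-negative if $f(A)\ge 0$ for all $A$. A value-oracle query returns $f(A)$ for a queried set $A$. The function need not be monotone. *)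

(* Defs.v *)
From HB Require Import structures.
From mathcomp Require Import all_boot all_order all_algebra.
From mathcomp Require Import reals.
Set Implicit Arguments. Unset Strict Implicit. Unset Printing Implicit Defensive.
Import Order.TTheory GRing.Theory Num.Theory.
Local Open Scope ring_scope.

Definition nonnegative (R : realType) (n : nat) (f : {set 'I_n} -> R) : Prop :=
  forall A, 0 <= f A.

Definition submodular (R : realType) (n : nat) (f : {set 'I_n} -> R) : Prop :=
  forall (A B : {set 'I_n}) (s : 'I_n), A \subset B -> s \notin B ->
    f (s |: A) - f A >= f (s |: B) - f B.

(* A randomized value-oracle algorithm on ground set 'I_n (real-RAM model):
   - Ret S      : output the set S;
   - Query A c  : ask the oracle for f(A), continue with c (f A);
   - Flip p c   : flip a coin that is true with probability p (clamped to
                  [0,1]), continue with c b. *)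
Inductive oalg (R : realType) (n : nat) : Type :=
| Ret of {set 'I_n}
| Query of {set 'I_n} & (R -> oalg R n)
| Flip of R & (bool -> oalg R n).

Definition clamp01 (R : realType) (p : R) : R := Num.min 1 (Num.max 0 p).

Fixpoint expected_value (R : realType) (n : nat) (f : {set 'I_n} -> R)
    (t : oalg R n) : R :=
  match t with
  | Ret X => f X
  | Query A c => expected_value f (c (f A))
  | Flip p c => clamp01 p * expected_value f (c true)
                + (1 - clamp01 p) * expected_value f (c false)
  end.

Fixpoint num_queries (R : realType) (n : nat) (f : {set 'I_n} -> R)
    (t : oalg R n) : nat :=
  match t with
  | Ret _ => 0
  | Query A c => (num_queries f (c (f A))).+1
  | Flip _ c => maxn (num_queries f (c true)) (num_queries f (c false))
  end.

Fixpoint outputs_size_le (R : realType) (n : nat) (f : {set 'I_n} -> R)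
    (k : nat) (t : oalg R n) : Prop :=
  match t with
  | Ret X => (#|X| <= k)%N
  | Query A c => outputs_size_le f k (c (f A))
  | Flip _ c => outputs_size_le f k (c true) /\ outputs_size_le f k (c false)
  end.

(* Main.v *)
Require Import Defs.
From HB Require Import structures.
From mathcomp Require Import all_boot all_order all_algebra.
From mathcomp Require Import boolp reals sequences exp.
From mathcomp Require Import lra ring zify.
From Stdlib Require Import Zify.
Set Implicit Arguments. Unset Strict Implicit. Unset Printing Implicit Defensive.
Import Order.TTheory GRing.Theory Num.Theory.
Local Open Scope ring_scope.

(** The algorithm runs a local search and, with a suitable probability, replaces
its result [Z] by the outcome of a random greedy procedure that avoids [Z]
during its first [s] steps and uses all elements during the last [k - s].

- With [q = 1 - 1/k], a step that picks every element with probability at most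
  [1/k] preserves a fraction [q] of [f (X :|: A)] in expectation; when the
  elements of [Z] are avoided, [f (X :|: A)] moreover never drops below
  [f X - f (X :|: Z)].  Applied to [X = OPT :\: Z] and then to [X = OPT], this
  bounds the greedy value from below by a linear form in [f OPT],
  [f (Z :&: OPT)] and [f (Z :|: OPT)].
- A local optimum has [f (Z :|: OPT) + f (Z :&: OPT) <= 2 f Z] and
  [f (Z :&: OPT) <= f Z].  These hold approximately and on average for the state
  of a swap-based local search at a uniformly random time before [L k], since the
  deficits bound the expected gains, which telescope.
- Neither procedure looks at the whole ground set: a step only examines about
  [c n / k] independent uniform elements, with [c] a large constant.  A random
  element among the [c] best of them still has selection probability at most
  [1/k], and by a second-moment estimate it does almost as well as a uniform
  element of any given set of size [k].
- Mixing the two outputs cancels the dependency on [f Z]; the resulting ratio is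
  above [131/340 > 0.385] when [s/k] is close to [78/209]. *)

(** * Programs with a value oracle *)

Section Programs.
Variables (R : realType) (n : nat).
Implicit Types (f G H : {set 'I_n} -> R) (t : oalg R n) (P : {set 'I_n} -> Prop).

Fixpoint bind t (c : {set 'I_n} -> oalg R n) : oalg R n :=
  match t with
  | Ret X => c X
  | Query A g => Query A (fun x => bind (g x) c)
  | Flip p g => Flip p (fun b => bind (g b) c)
  end.

Fixpoint Ev f G t : R :=
  match t with
  | Ret X => G X
  | Query A c => Ev f G (c (f A))
  | Flip p c => clamp01 p * Ev f G (c true) + (1 - clamp01 p) * Ev f G (c false)
  end.

Fixpoint leaves f P t : Prop :=
  match t with
  | Ret X => P X
  | Query A c => leaves f P (c (f A))
  | Flip p c => leaves f P (c true) /\ leaves f P (c false)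
  end.

Lemma clamp01_ge0 (p : R) : 0 <= clamp01 p.
Proof. by rewrite /clamp01 le_min ler01 le_max lexx. Qed.

Lemma clamp01_le1 (p : R) : clamp01 p <= 1.
Proof. by rewrite /clamp01 ge_min lexx. Qed.

Lemma clamp01_id (p : R) : 0 <= p <= 1 -> clamp01 p = p.
Proof.
by case/andP=> p0 p1; rewrite /clamp01 (max_idPr p0) (min_idPr p1).
Qed.

Lemma expected_valueE f t : expected_value f t = Ev f f t.
Proof. by elim: t => //= p c IH; rewrite !IH. Qed.

Lemma outputs_size_leE f k t :
  outputs_size_le f k t = leaves f (fun X => (#|X| <= k)%N : Prop) t.
Proof. by elim: t => //= p c IH; rewrite !IH. Qed.

Lemma Ev_bind f G t c : Ev f G (bind t c) = Ev f (fun X => Ev f G (c X)) t.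
Proof. by elim: t => //= p g IH; rewrite !IH. Qed.

Lemma leaves_bind f P t c :
  leaves f (fun X => leaves f P (c X)) t -> leaves f P (bind t c).
Proof.
by elim: t => [X|A g IH|p g IH] //= => [/IH //|[h1 h2]]; split; apply: IH.
Qed.

Lemma leaves_impl f P1 P2 t : (forall X, P1 X -> P2 X) ->
  leaves f P1 t -> leaves f P2 t.
Proof.
move=> h; elim: t => [X|A c IH|p c IH] /= => [|h1|[h1 h2]]; first exact: h.
  exact: IH.
by split; apply: IH.
Qed.

Lemma leaves_true f t : leaves f (fun=> True) t.
Proof. by elim: t => [X|A c IH|p c IH] /=; [|exact: IH|split; exact: IH]. Qed.

Lemma num_queries_bind f b t c :
  leaves f (fun X => (num_queries f (c X) <= b)%N : Prop) t ->
  (num_queries f (bind t c) <= num_queries f t + b)%N.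
Proof.
elim: t => [X|A g IH|p g IH] //= => [h|[h1 h2]].
  by rewrite addSn ltnS; apply: IH.
rewrite geq_max; apply/andP; split; apply: (leq_trans (IH _ _)) => //.
  by rewrite leq_add2r leq_maxl.
by rewrite leq_add2r leq_maxr.
Qed.

Lemma ler_Ev f P G H t : leaves f P t -> (forall X, P X -> G X <= H X) ->
  Ev f G t <= Ev f H t.
Proof.
move=> + GH; elim: t => [X|A c IH|p c IH] /= => [|h|[h1 h2]].
- exact: GH.
- exact: IH.
rewrite lerD // ler_wpM2l ?clamp01_ge0 ?subr_ge0 ?clamp01_le1 //.
  exact: IH.
exact: IH.
Qed.

Lemma Ev_cst f a t : Ev f (fun=> a) t = a.
Proof. by elim: t => //= p c IH; rewrite !IH; ring. Qed.

Lemma EvD f G H t : Ev f (fun X => G X + H X) t = Ev f G t + Ev f H t.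
Proof. by elim: t => //= p c IH; rewrite !IH; ring. Qed.

Lemma EvZ f a G t : Ev f (fun X => a * G X) t = a * Ev f G t.
Proof. by elim: t => //= p c IH; rewrite !IH; ring. Qed.

Lemma EvB f G H t : Ev f (fun X => G X - H X) t = Ev f G t - Ev f H t.
Proof. by elim: t => //= p c IH; rewrite !IH; ring. Qed.

(** * Batches of queries and uniform sampling *)

Fixpoint queries (s : seq {set 'I_n}) (c : ({set 'I_n} -> R) -> oalg R n) :=
  if s is X :: s' then
    Query X (fun v => queries s' (fun g => c (fun Y => if Y == X then v else g Y)))
  else c (fun=> 0).

(** The oracle as the continuation of [queries] sees it: unqueried entries read 0. Each procedure
    below therefore needs a proof that it consults queried sets only, as in [gain_tab] and
    [estimate_tab]. *)
Fixpoint tab f (s : seq {set 'I_n}) : {set 'I_n} -> R :=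
  if s is X :: s' then fun Y => if Y == X then f X else tab f s' Y
  else fun=> 0.

Lemma tabE f s X : X \in s -> tab f s X = f X.
Proof.
elim: s => //= Y s IH; rewrite inE; case: eqVneq => [->|_] //=.
Qed.

Lemma Ev_queries f G s c : Ev f G (queries s c) = Ev f G (c (tab f s)).
Proof. by elim: s c => //= X s IH c; rewrite IH. Qed.

Lemma leaves_queries f P s c :
  leaves f P (c (tab f s)) -> leaves f P (queries s c).
Proof. by elim: s c => //= X s IH c; apply: IH. Qed.

Lemma num_queries_queries f s c :
  num_queries f (queries s c) = (size s + num_queries f (c (tab f s)))%N.
Proof. by elim: s c => //= X s IH c; rewrite IH. Qed.

Definition mean (T : Type) (s : seq T) (g : T -> R) : R :=
  (size s)%:R^-1 * \sum_(x <- s) g x.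

(** The last coin has probability 1, but its false branch [Ret R set0] still counts as a leaf; hence
    the hypothesis [P set0] of [leaves_unif]. *)
Fixpoint unif (T : Type) (s : seq T) (c : T -> oalg R n) : oalg R n :=
  if s is x :: s' then
    Flip (size s)%:R^-1 (fun b => if b then c x else unif s' c)
  else Ret R set0.

Lemma Ev_unif f G (T : Type) (s : seq T) c : (0 < size s)%N ->
  Ev f G (unif s c) = mean s (fun x => Ev f G (c x)).
Proof.
elim: s => // x s IH _; rewrite [LHS]/=.
have s1 : (0 : R) < (size s).+1%:R by rewrite ltr0n.
rewrite clamp01_id; last first.
  by rewrite invr_ge0 ltW //= invf_le1 // ler1n.
case: s IH s1 => [_ _|y s IH s1].
  by rewrite /mean big_cons big_nil /= invr1; ring.
rewrite IH // /mean [in RHS]big_cons /=; set S := \sum_(_ <- _) _.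
have s0 : (0 : R) < (size s).+1%:R by rewrite ltr0n.
rewrite -[(size s).+2%:R]natr1; move: s0; set a : R := (size s).+1%:R => s0.
by field; rewrite !lt0r_neq0 //; lra.
Qed.

Lemma leaves_unif f P (T : eqType) (s : seq T) c : P set0 ->
  (forall x, x \in s -> leaves f P (c x)) -> leaves f P (unif s c).
Proof.
move=> P0; elim: s => //= x s IH h; split; first by apply: h; rewrite mem_head.
by apply: IH => y ys; apply: h; rewrite inE ys orbT.
Qed.

Lemma num_queries_unif f b (T : eqType) (s : seq T) c :
  (forall x, x \in s -> (num_queries f (c x) <= b)%N) ->
  (num_queries f (unif s c) <= b)%N.
Proof.
elim: s => //= x s IH h; rewrite geq_max h ?mem_head //=.
by apply: IH => y ys; apply: h; rewrite inE ys orbT.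
Qed.

Fixpoint draw (r : nat) (c : seq 'I_n -> oalg R n) : oalg R n :=
  if r is r'.+1 then unif (enum 'I_n) (fun u => draw r' (fun s => c (u :: s)))
  else c [::].

Fixpoint Ed (r : nat) (G : seq 'I_n -> R) : R :=
  if r is r'.+1 then n%:R^-1 * \sum_(u < n) Ed r' (fun s => G (u :: s))
  else G [::].

Lemma Ed_le r (G H : seq 'I_n -> R) :
  (forall s, size s = r -> G s <= H s) -> Ed r G <= Ed r H.
Proof.
elim: r G H => [|r IH] G H GH /=; first exact: GH.
rewrite ler_wpM2l ?invr_ge0 ?ler0n //; apply: ler_sum => u _.
by apply: IH => s ss; apply: GH => /=; rewrite ss.
Qed.

Lemma eq_Ed r (G H : seq 'I_n -> R) :
  (forall s, size s = r -> G s = H s) -> Ed r G = Ed r H.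
Proof.
by move=> GH; apply/eqP; rewrite eq_le !Ed_le // => s ss; rewrite GH.
Qed.

Lemma EdD r (G H : seq 'I_n -> R) :
  Ed r (fun s => G s + H s) = Ed r G + Ed r H.
Proof.
elim: r G H => [|r IH] G H //=; rewrite -mulrDr -big_split /=.
by congr (_ * _); apply: eq_bigr => u _; rewrite IH.
Qed.

Lemma EdZ r a (G : seq 'I_n -> R) : Ed r (fun s => a * G s) = a * Ed r G.
Proof.
elim: r G => [|r IH] G //=; rewrite [RHS]mulrCA [in RHS]mulr_sumr.
by congr (_ * _); apply: eq_bigr => u _; rewrite IH.
Qed.

Lemma Ed_cst r a : (0 < n)%N -> Ed r (fun=> a) = a.
Proof.
move=> n0; have nR : (n%:R : R) != 0 by rewrite pnatr_eq0 -lt0n.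
elim: r => //= r IH; under eq_bigr do rewrite IH.
by rewrite sumr_const card_ord -[a *+ n]mulr_natl mulKf.
Qed.

Lemma Ev_draw f G r c : (0 < n)%N ->
  Ev f G (draw r c) = Ed r (fun s => Ev f G (c s)).
Proof.
move=> n0; elim: r c => //= r IH c; rewrite Ev_unif ?size_enum_ord // /mean.
rewrite size_enum_ord big_enum /=; congr (_ * _); apply: eq_bigr => u _.
exact: IH.
Qed.

Lemma leaves_draw f P r c : P set0 ->
  (forall s, size s = r -> leaves f P (c s)) -> leaves f P (draw r c).
Proof.
move=> P0; elim: r c => /= [|r IH] c h; first exact: h.
apply: leaves_unif => // u _; apply: IH => s ss.
by apply: h => /=; rewrite ss.
Qed.

Lemma num_queries_draw f b r c :
  (forall s, size s = r -> (num_queries f (c s) <= b)%N) ->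
  (num_queries f (draw r c) <= b)%N.
Proof.
elim: r c => /= [|r IH] c h; first exact: h.
apply: num_queries_unif => // u _; apply: IH => s ss.
by apply: h => /=; rewrite ss.
Qed.

End Programs.

(** * Submodular functions *)

Section Submodular.
Variables (R : realType) (n : nat).
Implicit Types (f : {set 'I_n} -> R) (A B S : {set 'I_n}).

(** The left side telescopes over the elements of [S], and each increment is a marginal value over a
    superset of [A]. *)
Lemma submodular_sum f A S : submodular f ->
  f (S :|: A) - f A <= \sum_(u in S) (f (u |: A) - f A).
Proof.
move=> sf; elim: {S}#|S| {-2}S (erefl #|S|) => [|m IH] S.
  by move/eqP; rewrite cards_eq0 => /eqP ->; rewrite set0U subrr big_set0.
move=> cS; have /card_gt0P[x xS] : (0 < #|S|)%N by rewrite cS.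
have cS' : #|S :\ x| = m by have := cardsD1 x S; rewrite xS cS => -[].
have := IH _ cS'; rewrite (big_setD1 x xS) /= => IH'.
have SE : S :|: A = x |: (S :\ x :|: A) by rewrite setUA setD1K.
suff : f (S :|: A) - f (S :\ x :|: A) <= f (x |: A) - f A by lra.
have [xA|xA] := boolP (x \in A).
  have -> : x |: A = A by apply/setUidPr; rewrite sub1set.
  have -> : S :|: A = S :\ x :|: A.
    by rewrite SE; apply/setUidPr; rewrite sub1set !inE xA orbT.
  by rewrite !subrr.
by rewrite SE; apply: sf; rewrite ?subsetUr // !inE eqxx (negbTE xA).
Qed.

(** The elements of [A :\: B] are inserted one at a time into [B] and, in parallel, into [A :&: B];
    diminishing returns compare the two runs. *)
Lemma submodularUI f A B : submodular f ->
  f (A :|: B) + f (A :&: B) <= f A + f B.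
Proof.
move=> sf.
suff H S (C : {set 'I_n}) : [disjoint S & B] -> C \subset B ->
    f (S :|: B) - f B <= f (S :|: C) - f C.
  have dAB : [disjoint A :\: B & B].
    by rewrite -setI_eq0 setDE -setIA [~: B :&: B]setIC setICr setI0.
  have AUB : A :\: B :|: B = A :|: B.
    by apply/setP => x; rewrite !inE; case: (x \in B); rewrite ?orbT.
  have := H _ _ dAB (subsetIr A B); rewrite AUB [A :\: B :|: _]setUC setID; lra.
elim: {S}#|S| {-2}S (erefl #|S|) => [|m IH] {}S.
  by move/eqP; rewrite cards_eq0 => /eqP ->; rewrite !set0U !subrr.
move=> cS dS CB; have /card_gt0P[x xS] : (0 < #|S|)%N by rewrite cS.
have cS' : #|S :\ x| = m by have := cardsD1 x S; rewrite xS cS => -[].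
have dS' : [disjoint S :\ x & B] by apply: disjointWl dS; apply: subsetDl.
have := IH _ cS' dS' CB.
have xB : x \notin B by move/disjointFr: dS => ->.
have SE D : S :|: D = x |: (S :\ x :|: D) by rewrite setUA setD1K.
have : f (x |: (S :\ x :|: B)) - f (S :\ x :|: B) <=
       f (x |: (S :\ x :|: C)) - f (S :\ x :|: C).
  by apply: sf; rewrite ?setUS // !inE eqxx (negbTE xB).
by rewrite -!SE; lra.
Qed.

(** Complementation exchanges insertions and deletions, so bounds for deletions follow from those
    for insertions. *)
Lemma submodular_setC f : submodular f -> submodular (fun S => f (~: S)).
Proof.
move=> sf A B s AB sB.
have E S : s \notin S -> ~: S = s |: ~: (s |: S).
  move=> sS; apply/setP => x; rewrite !inE negb_or.
  by case: eqVneq => [->|] //=; rewrite sS.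
have sA : s \notin A by apply: contra sB; apply: (subsetP AB).
have := sf (~: (s |: B)) (~: (s |: A)) s.
rewrite setCS setUS // !inE eqxx -!E //= => /(_ isT isT); lra.
Qed.

Lemma submodular_sum_del f A S : submodular f ->
  f (A :\: S) - f A <= \sum_(u in S) (f (A :\ u) - f A).
Proof.
move=> sf; have /= := @submodular_sum _ (~: A) S (submodular_setC sf).
rewrite !setCU !setCK setIC -setDE => /le_trans; apply.
by apply: ler_sum => u _; rewrite !setCU !setCK setIC -setDE.
Qed.

End Submodular.

(** * The numerical inequality *)

Lemma pred_subnE (k s : nat) : (s < k)%N ->
  [/\ (k.-1 = (k - s).-1 + s)%N, ((k - s).-1.+1 = k - s)%N & (k.-1.+1 = k)%N].
Proof. by move=> sk; split; lia. Qed.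

Section Numerics.
Variable R : realType.

(** With y = x - x^2/5, cubing 1 + y/3 <= exp(y/3) yields at least 1 + y + y^2/3, and y^2/3 makes up
    for the subtracted x^2/5. *)
Lemma expR_lb_cube (x : R) : 0 <= x <= 1 -> 1 + x <= expR (x - x ^+ 2 / 5).
Proof.
move=> /andP[x0 x1]; set y := x - _.
have y0 : 0 <= y by rewrite /y; nra.
have -> : expR y = expR (y / 3) ^+ 3.
  by rewrite -expRM_natl; congr expR; field.
apply: (@le_trans _ _ ((1 + y / 3) ^+ 3)); last first.
  by rewrite lerXn2r ?nnegrE ?expR_ge0 ?expR_ge1Dx //; lra.
have -> : (1 + y / 3) ^+ 3 = 1 + y + y ^+ 2 / 3 + y ^+ 3 / 27 by field.
have y3 : 0 <= y ^+ 3 / 27 by rewrite divr_ge0 ?exprn_ge0.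
have : x ^+ 2 / 5 <= y ^+ 2 / 3.
  have -> : y = x * (1 - x / 5) by rewrite /y; field.
  have h : 5^-1 <= (1 - x / 5) ^+ 2 / 3 by nra.
  by have := ler_wpM2l (sqr_ge0 x) h; rewrite exprMn; lra.
by rewrite {2}/y; lra.
Qed.

(** This is 1 - 1/(N+1) <= exp(-1/(N+1)) raised to the power [j]; it turns numerical bounds on the
    exponential into comparisons of integers. *)
Lemma expRN_lb_pow (N j c d : nat) : (0 < d)%N ->
  (c * N.+1 ^ j <= d * N ^ j)%N ->
  c%:R / d%:R <= expR (- (j%:R / N.+1%:R)) :> R.
Proof.
move=> d0 h; have N0 : (0 : R) < N.+1%:R by rewrite ltr0n.
have d0' : (0 : R) < d%:R by rewrite ltr0n.
apply: (@le_trans _ _ ((N%:R / N.+1%:R) ^+ j)).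
  rewrite expr_div_n ler_pdivrMr // mulrAC ler_pdivlMr ?exprn_gt0 //.
  by rewrite -!natrX -!natrM ler_nat [leqRHS]mulnC.
rewrite -mulrN expRM_natl lerXn2r ?nnegrE ?expR_ge0 ?divr_ge0 ?ler0n //.
apply: le_trans (expR_ge1Dx _); rewrite -[N.+1%:R]natr1 ler_pdivrMr; last first.
  by rewrite natr1.
by rewrite mulrDl mulNr mulVf ?natr1 ?lt0r_neq0 // mul1r -natr1 addrK.
Qed.

Lemma pow1024_lb : (919 * 1024 ^ 1024 <= 2500 * 1023 ^ 1024)%N.
Proof. by zify; vm_compute. Qed.

(** The exponent is 1024 * (1 - 78/209) = 641.8... rounded up. *)
Lemma pow642_lb : (534 * 1024 ^ 642 <= 1000 * 1023 ^ 642)%N.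
Proof. by zify; vm_compute. Qed.

(** * Choice of the lengths of the two greedy phases *)

Local Notation x0 := (131 / 340 : R).
Local Notation tau0 := (78 / 209 : R).

Lemma expRN1_lb : 919 / 2500 <= expR (- 1) :> R.
Proof.
have := expRN_lb_pow (N := 1023) (d := 2500) isT pow1024_lb.
by rewrite divff ?pnatr_eq0.
Qed.

Lemma expR_tau0_lb : 534 / 1000 <= expR (tau0 - 1) :> R.
Proof.
apply: le_trans (expRN_lb_pow (N := 1023) (d := 1000) isT pow642_lb) _.
by rewrite ler_expR; lra.
Qed.

(** Here [a] is the number of unrestricted greedy steps. The inequality is the guarantee of the
    mixture with its denominator cleared, see [split_ratio]. For k <= 11 a table of suitable [a] is
    checked by rational arithmetic; its entry at 0 is a dummy. *)
Lemma small_split (k a : nat) (q : R) : (0 < k <= 11)%N ->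
  a = nth 0%N [:: 0; 1; 2; 2; 3; 4; 4; 5; 6; 6; 7; 7]%N k -> q = 1 - k%:R^-1 ->
  x0 <= (1 - 2 * x0) * (q ^+ a - q ^+ k) +
    (1 - x0) * (a%:R / k%:R * q ^+ a.-1) + x0 * q ^+ k.-1.
Proof.
move=> k11 -> ->.
case: k k11 => [//|k] k11.
have -> : 1 - k.+1%:R^-1 = k%:R / k.+1%:R :> R.
  by rewrite -[k.+1%:R]natr1; field; rewrite natr1 pnatr_eq0.
move: k11; do 11 (case: k => [_|k]; [by rewrite /=; lra|]).
by [].
Qed.

(** Here [e] stands for 1/k and [d] for the rounding error of s/k against [tau0]. The error enters
    only squared, so d^2 <= e/12 leaves one variable, and the factor 1 + e/5 pays for all losses of
    order [e]. *)
Lemma split_poly (e d : R) : 0 <= e <= 1 / 12 -> 0 <= d <= e ->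
  x0 <= (1 + e / 5) * (534 / 1000 * ((1 - x0) * (1 - d ^+ 2)) +
    919 / 2500 * (x0 - (1 - 2 * x0) - 41 / 300 * e)).
Proof.
move=> /andP[e0 e1] /andP[d0 d1].
have d2 : d ^+ 2 <= e / 12 by nra.
suff : x0 <= (1 + e / 5) * (534 / 1000 * ((1 - x0) * (1 - e / 12)) +
    919 / 2500 * (x0 - (1 - 2 * x0) - 41 / 300 * e)).
  move/le_trans; apply; rewrite ler_pM2l ?lerD2r; last by lra.
  by lra.
by nra.
Qed.

Lemma exprn_onem_lb (e : R) j : 0 <= e <= 1 -> 1 - j%:R * e <= (1 - e) ^+ j.
Proof.
move=> /andP[e0 e1]; elim: j => [|j IH]; first by rewrite mul0r subr0 expr0.
rewrite exprS -natr1; have := @ler_wpM2l R (1 - e) _ _ _ IH.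
rewrite subr_ge0 => /(_ e1); have : (0 : R) <= j%:R by rewrite ler0n.
by move: (_ ^+ _) (j%:R) => x y; nra.
Qed.

Lemma expR_le_pow_inv (e : R) j : 0 <= e < 1 ->
  expR (j%:R * e) <= ((1 - e) ^+ j)^-1.
Proof.
move=> /andP[e0 e1]; have q0 : 0 < 1 - e by rewrite subr_gt0.
rewrite -[expR _]invrK lef_pV2 ?posrE ?invr_gt0 ?expR_gt0 ?exprn_gt0 //.
rewrite -expRN -mulrN expRM_natl lerXn2r ?nnegrE ?expR_ge0 ?(ltW q0) //.
exact: expR_ge1Dx.
Qed.

(** With m = k - 1 the right side is (1 + 1/m)^(-m), and [expR_lb_cube] at 1/m bounds it below by
    exp(-1 + 1/(5m)). The gain over 1/e is what absorbs the rounding losses for large [k]. *)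
Lemma pow_pred_lb (k : nat) : (1 < k)%N ->
  expR (- 1) * (1 + k%:R^-1 / 5) <= (1 - k%:R^-1) ^+ k.-1 :> R.
Proof.
case: k => [|[|m]] // _; rewrite [m.+2.-1]/= -[m.+2%:R]natr1.
have : (1 : R) <= m.+1%:R by rewrite ler1n.
move: (m.+1) => {}m m1; set M : R := m%:R in m1 *.
have m0 : 0 < M by apply: lt_le_trans m1.
have M1 : 0 <= M^-1 <= 1 by rewrite invr_ge0 (ltW m0) invf_le1.
have -> : 1 - (M + 1)^-1 = (1 + M^-1)^-1.
  by clear -m0; field; rewrite !lt0r_neq0 //; lra.
have -> : (1 + M^-1)^-1 ^+ m = ((1 + M^-1) ^+ m)^-1 by rewrite exprVn.
have /andP[M0 _] := M1; have b0 : 0 < 1 + M^-1 by apply: ltr_wpDr.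
apply: (@le_trans _ _ (expR (- (M * (M^-1 - M^-1 ^+ 2 / 5))))); last first.
  rewrite expRN lef_pV2 ?posrE ?exprn_gt0 ?expR_gt0 //.
  by rewrite expRM_natl lerXn2r ?nnegrE ?expR_ge0 ?(ltW b0) ?expR_lb_cube.
have -> : - (M * (M^-1 - M^-1 ^+ 2 / 5)) = - 1 + M^-1 / 5.
  by clear -m0; field; rewrite lt0r_neq0.
rewrite expRD ler_pM2l ?expR_gt0 //; apply: le_trans (expR_ge1Dx _).
rewrite lerD2l ler_pM2r ?invr_gt0 // lef_pV2 ?posrE ?lerDl //.
by rewrite addr_gt0.
Qed.

(** [B] is the target expression divided by q^(k-1), with e = 1/k, tau = s/k and z = q^(-s). In the
    limit its dependence on tau is exp(tau) * ((1 - 2 * x0) + (1 - x0) * (1 - tau)), which is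
    maximal at [tau0] = (1 - 2 * x0) / (1 - x0). *)
Lemma split_bracket (e tau z : R) : 0 <= e <= 1 / 12 -> tau0 - e <= tau <= tau0 ->
  expR tau <= z -> z <= (1 - tau0)^-1 ->
  let B := (1 - 2 * x0) * ((1 - e) * (z - 1)) + (1 - x0) * (1 - tau) * z + x0 in
  0 <= B /\ x0 <= expR (- 1) * (1 + e / 5) * B.
Proof.
move=> e12 /andP[tau2 tau1] zlb zub B; have /andP[e0 e1] := e12.
pose d := tau0 - tau.
have d0 : 0 <= d <= e by rewrite subr_ge0 tau1 lerBlDr addrC -lerBlDr.
have tauE : expR tau0 * (1 - d) <= z.
  apply: le_trans zlb; have -> : tau = tau0 + - d by rewrite opprB addrC subrK.
  by rewrite expRD ler_pM2l ?expR_gt0 // expR_ge1Dx.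
(* The bound 209/131 is 1 / (1 - [tau0]), and (1 - 2 * x0) * 78/131 is just below 41/300. *)
have z1 : (1 - 2 * x0) * (z - 1) <= 41 / 300.
  have {}zub : z <= 209 / 131.
    by apply: le_trans zub _; rewrite le_eqVlt; apply/orP; left; apply/eqP; field.
  by clear -zub; lra.
have d1 : 0 <= 1 + d by case/andP: d0 => d0 _; rewrite addr_ge0.
have x1 : 0 <= 1 - x0 by clear; lra.
pose W := expR tau0 * ((1 - x0) * (1 - d ^+ 2)).
have WE : W <= z * ((1 - x0) * (1 + d)).
  have := ler_wpM2r (mulr_ge0 x1 d1) tauE; apply: le_trans.
  by rewrite /W le_eqVlt; apply/orP; left; apply/eqP; clear; ring.
(* By the choice of [tau0] the coefficient of [z], apart from the term in [e], is (1 - x0) * (1 +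
   d). Multiplied with z >= exp(tau0) * (1 - d), this leaves the error d^2 only. *)
have BE : B = z * ((1 - x0) * (1 + d)) + (x0 - (1 - 2 * x0)) -
    (1 - 2 * x0) * (z - 1) * e.
  by rewrite /B /d; clear; field.
pose L := W + (x0 - (1 - 2 * x0) - 41 / 300 * e).
have BL : L <= B.
  by rewrite BE -[leRHS]addrA lerD // lerD2l lerN2 ler_wpM2r.
have poly := split_poly e12 d0.
have dd : 0 <= (1 - x0) * (1 - d ^+ 2).
  have /andP[dge0 de] := d0.
  rewrite mulr_ge0 // subr_ge0 exprn_ile1 // (le_trans de) // (le_trans e1) //.
  by clear; lra.
have U0 : 0 <= x0 - (1 - 2 * x0) - 41 / 300 * e.
  by clear -e1; lra.
have L0 : 0 <= L by rewrite addr_ge0 // mulr_ge0 ?expR_ge0.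
have e5 : 0 <= 1 + e / 5 by rewrite addr_ge0 // divr_ge0.
split; first exact: le_trans BL.
apply: le_trans poly _.
have -> : expR (- 1) * (1 + e / 5) * B = (1 + e / 5) * (expR (- 1) * B).
  by rewrite mulrCA mulrA.
rewrite ler_wpM2l //.
apply: (@le_trans _ _ (expR (- 1) * L)); last by rewrite ler_wpM2l ?expR_ge0.
rewrite /L /W [leRHS]mulrDr [expR (- 1) * _]mulrA -expRD [- 1 + _]addrC.
rewrite lerD // ler_wpM2r //.
  exact: expR_tau0_lb.
exact: expRN1_lb.
Qed.

Lemma large_split (k : nat) (q : R) : (11 < k)%N -> q = 1 - k%:R^-1 ->
  exists2 a : nat, (a <= k)%N &
  x0 <= (1 - 2 * x0) * (q ^+ a - q ^+ k) +
    (1 - x0) * (a%:R / k%:R * q ^+ a.-1) + x0 * q ^+ k.-1.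
Proof.
move=> k12 qE; pose e : R := k%:R^-1.
have k_gt0 : (0 : R) < k%:R by rewrite ltr0n (leq_trans _ k12).
have e0 : 0 < e by rewrite invr_gt0.
have k12R : (12 : R) <= k%:R by rewrite ler_nat.
have e12 : e <= 1 / 12 by rewrite div1r /e lef_pV2 ?posrE.
have tau00 : 0 <= tau0 by rewrite divr_ge0 ?ler0n.
have tau01 : tau0 < 1 by clear; lra.
(* The restricted phase gets s = floor(tau0 * k) steps, the unrestricted one the remaining k - s. *)
have /andP[s1 s2] := truncn_itv (mulr_ge0 tau00 (ltW k_gt0)).
set s := Num.truncn _ in s1 s2.
have sk : (s < k)%N.
  by rewrite -(ltr_nat R); apply: le_lt_trans s1 _; rewrite gtr_pMl.
have [n1 n2 n3] := pred_subnE sk.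
pose tau : R := s%:R * e.
have tau1 : tau <= tau0 by rewrite /tau ler_pdivrMr.
have tau2 : tau0 - e <= tau.
  by rewrite lerBlDr /tau -[X in _ + X]mul1r -mulrDl natr1 ler_pdivlMr // ltW.
have e1 : e < 1 by apply: le_lt_trans e12 _; clear; lra.
have q0 : 0 < q by rewrite qE subr_gt0.
pose y := q ^+ k.-1; pose z := (q ^+ s)^-1.
have y0 : 0 < y by rewrite exprn_gt0.
have qs0 : 0 < q ^+ s by rewrite exprn_gt0.
exists (k - s)%N; first by rewrite leq_subr.
have E1 : q ^+ (k - s).-1 = y * z.
  by rewrite /y /z n1 exprD mulfK ?lt0r_neq0.
have E2 : q ^+ (k - s) = q * (y * z) by rewrite -E1 -exprS n2.
have E3 : q ^+ k = q * y by rewrite -exprS n3.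
have E4 : (k - s)%:R / k%:R = 1 - tau.
  by rewrite natrB 1?ltnW // mulrBl divff ?lt0r_neq0.
rewrite E1 E2 E3 E4 -/y.
have zlb : expR tau <= z by rewrite /z qE expR_le_pow_inv // (ltW e0).
(* Bernoulli's inequality: q^s >= 1 - s/k >= 1 - tau0. *)
have zub : z <= (1 - tau0)^-1.
  rewrite lef_pV2 ?posrE ?subr_gt0 //; apply: (@le_trans _ _ (1 - tau)).
    by rewrite lerD2l lerN2.
  by rewrite qE exprn_onem_lb // (ltW e0) (ltW e1).
have [] := @split_bracket e tau z _ _ zlb zub; rewrite ?(ltW e0) ?tau1 ?tau2 //.
set B := _ + _ => B0 /le_trans; apply.
have -> : (1 - 2 * x0) * (q * (y * z) - q * y) + (1 - x0) * ((1 - tau) * (y * z)) +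
   x0 * y = y * B by rewrite /B qE -/e; clear; ring.
by rewrite ler_wpM2r // /y qE pow_pred_lb // (leq_trans _ k12).
Qed.

Lemma split_exists (k : nat) (q : R) : (0 < k)%N -> q = 1 - k%:R^-1 ->
  exists2 a : nat, (a <= k)%N &
  x0 <= (1 - 2 * x0) * (q ^+ a - q ^+ k) +
    (1 - x0) * (a%:R / k%:R * q ^+ a.-1) + x0 * q ^+ k.-1.
Proof.
move=> k0 qE; have [k11|k12] := leqP k 11; last exact: large_split.
exists (nth 0%N [:: 0; 1; 2; 2; 3; 4; 4; 5; 6; 6; 7; 7]%N k); last first.
  by apply: small_split; rewrite ?k0.
by case: k {k0 qE} k11 => [//|k]; do 11 (case: k => [//|k]).
Qed.

End Numerics.

(** * Sampling *)

(** [mu] is the expected number of hits, within 1 of b = T^2, and its variance mu * (1 - p) is at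
    most [b]. The total loss is then at most 1/2 + (2T + 1)/4 <= T = b/T. *)
Lemma mean_var_arith (R : realType) (mu b T p E : R) :
  2 <= T -> b = T ^+ 2 -> 0 <= p -> mu <= b -> b - 1 <= mu ->
  (mu + b) / 2 - ((mu * (1 - p) + (mu - b) ^+ 2) / T + T) / 4 <= E ->
  (1 - T^-1) * b <= E.
Proof.
move=> T2 bE p0 mu1 mu2; apply: le_trans.
have -> : (1 - T^-1) * b = b - T by rewrite bE; field; lra.
have mu0 : 0 <= mu by nra.
have mp : mu * (1 - p) <= b by nra.
have md : (mu - b) ^+ 2 <= 1 by nra.
have : (mu * (1 - p) + (mu - b) ^+ 2) / T <= T + 1.
  by rewrite ler_pdivrMr; nra.
by set X := _ / T; lra.
Qed.

Section Sampling.
Variables (R : realType) (n : nat).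
Hypothesis n0 : (0 < n)%N.
Implicit Types (O : {set 'I_n}) (w : 'I_n -> R).

Let nR0 : (n%:R : R) != 0. Proof. by rewrite pnatr_eq0 -lt0n. Qed.

Lemma Ed_sum r w :
  Ed r (fun d => \sum_(x <- d) w x) = r%:R / n%:R * \sum_u w u.
Proof.
elim: r => [|r IH] /=; first by rewrite big_nil !mul0r.
have -> : \sum_(u < n) Ed r (fun s => \sum_(x <- u :: s) w x) =
    \sum_u (w u + r%:R / n%:R * \sum_v w v).
  apply: eq_bigr => u _; rewrite -IH -[X in X + _](Ed_cst r (w u) n0) -EdD.
  by apply: eq_Ed => s _; rewrite big_cons.
rewrite big_split /= sumr_const card_ord -[_ *+ n]mulr_natr -natr1.
by field.
Qed.

Definition hits O (d : seq 'I_n) : R := (count (mem O) d)%:R.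

Lemma sum_mem_if O (a b : R) :
  \sum_(u < n) (if u \in O then a else b) =
  #|O|%:R * a + (n%:R - #|O|%:R) * b.
Proof.
rewrite big_if /= !sumr_const -[a *+ _]mulr_natl -[b *+ _]mulr_natl; congr (_ + _ * _).
have -> : (n%:R : R) = #|O|%:R + #|[predC O]|%:R by rewrite -natrD cardC card_ord.
by rewrite addrAC subrr add0r.
Qed.

Lemma Ed_hits r O : Ed r (hits O) = r%:R * (#|O|%:R / n%:R).
Proof.
have -> : Ed r (hits O) = Ed r (fun d => \sum_(x <- d) (if x \in O then 1 else 0)).
  apply: eq_Ed => s _; rewrite /hits -sum1_count natr_sum big_mkcond /=.
  by apply: eq_bigr => u _.
by rewrite Ed_sum sum_mem_if; field.
Qed.

(** The centre [b] is arbitrary because a hit in the first draw shifts it to b - 1 in the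
    induction. *)
Lemma Ed_hits_var r O b : let p := #|O|%:R / n%:R in
  Ed r (fun d => (hits O d - b) ^+ 2) =
  r%:R * p * (1 - p) + (r%:R * p - b) ^+ 2.
Proof.
move=> p; elim: r b => [|r IH] b /=; first by rewrite /hits /=; ring.
have -> : \sum_(u < n) Ed r (fun s => (hits O (u :: s) - b) ^+ 2) =
    \sum_(u < n) (if u \in O then r%:R * p * (1 - p) + (r%:R * p - (b - 1)) ^+ 2
                  else r%:R * p * (1 - p) + (r%:R * p - b) ^+ 2).
  apply: eq_bigr => u _.
  case: ifP => uO; rewrite -IH; apply: eq_Ed => s _; rewrite /hits /= uO //.
  by rewrite natrD /=; congr (_ ^+ 2); ring.
by rewrite sum_mem_if -[r.+1%:R]natr1 /p; field.
Qed.

(** A draw that lands in [O] is uniform in [O], so each retained hit contributes the average weight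
    of [O]; only the number of retained hits remains. *)
Lemma Ed_take_filter r O w c : (0 < #|O|)%N ->
  Ed r (fun d => \sum_(u <- take c [seq x <- d | x \in O]) w u) =
  (\sum_(u in O) w u) / #|O|%:R * Ed r (fun d => (minn (count (mem O) d) c)%:R).
Proof.
move=> O0; have OR : (#|O|%:R : R) != 0 by rewrite pnatr_eq0 -lt0n.
elim: r c => [|r IH] c /=; first by rewrite big_nil min0n mulr0.
set W := _ / _; rewrite -/W in IH *.
rewrite [RHS]mulrCA; congr (_ * _); rewrite mulr_sumr.
rewrite (bigID (mem O)) [RHS](bigID (mem O)) /=; congr (_ + _); last first.
  apply: eq_bigr => u uO.
  transitivity (W * Ed r (fun d => (minn (count (mem O) d) c)%:R)).
    by rewrite -IH; apply: eq_Ed => s _; rewrite (negbTE uO).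
  by congr (_ * _); apply: eq_Ed => s _; rewrite /= (negbTE uO).
case: c => [|c].
  rewrite !big1 // => u uO.
    by rewrite (eq_Ed (H := fun=> 0)) ?Ed_cst ?mulr0 // => s _; rewrite minn0.
  by rewrite (eq_Ed (H := fun=> 0)) ?Ed_cst // => s _; rewrite take0 big_nil.
transitivity (\sum_(u in O) (w u + W * Ed r (fun d => (minn (count (mem O) d) c)%:R))).
  apply: eq_bigr => u uO; rewrite -IH -[X in X + _](Ed_cst r (w u) n0) -EdD.
  by apply: eq_Ed => s _; rewrite uO /= big_cons.
transitivity (\sum_(u in O) (W + W * Ed r (fun d => (minn (count (mem O) d) c)%:R))).
  rewrite !big_split /=; congr (_ + _).
  by rewrite sumr_const -mulr_natr /W divfK.
apply: eq_bigr => u uO; rewrite -EdZ -[X in X + _](Ed_cst r W n0) -EdD -EdZ.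
by apply: eq_Ed => s _; rewrite uO /= add1n minnSS -natr1; ring.
Qed.

Section Rate.
Variables (k t : nat).
Hypotheses (k0 : (0 < k)%N) (kn : (k <= n)%N) (t2 : (2 <= t)%N).

(** A set of size [k] receives about t^2 of these samples. Rounding down keeps rate / (t^2 * n) <=
    1/k, the bound on the probability of selecting a given element. *)
Definition rate : nat := (t ^ 2 * n) %/ k.

Let kR : (0 : R) < k%:R. Proof. by rewrite ltr0n. Qed.
Let nR : (0 : R) < n%:R. Proof. by rewrite ltr0n. Qed.
Let tR : (2%:R : R) <= t%:R. Proof. by rewrite ler_nat. Qed.

Lemma rate_ub : (rate%:R : R) * k%:R <= t%:R ^+ 2 * n%:R.
Proof. by rewrite -natrX -!natrM ler_nat leq_divM. Qed.

Lemma rate_lb : (t%:R ^+ 2 * n%:R : R) <= rate%:R * k%:R + n%:R.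
Proof.
rewrite -natrX -!natrM -natrD ler_nat {1}(divn_eq (t ^ 2 * n) k) leq_add2l.
by rewrite (leq_trans (ltnW (ltn_pmod _ k0))).
Qed.

Lemma rate_ge : (t ^ 2 <= rate)%N.
Proof. by rewrite leq_divRL // leq_mul2l kn orbT. Qed.

(* min(y, c) is bounded below by a quadratic in y tangent at c = t^2, so that
   mean and variance of the number of hits suffice. *)
Lemma minn_quadratic (y : nat) :
  (y%:R + t%:R ^+ 2) / 2 - ((y%:R - t%:R ^+ 2) ^+ 2 / t%:R + t%:R) / 4
  <= (minn y (t ^ 2))%:R :> R.
Proof.
have -> : (minn y (t ^ 2))%:R = Num.min y%:R (t%:R ^+ 2) :> R.
  by rewrite natr_min natrX.
set a : R := y%:R; set b : R := t%:R ^+ 2; have t0 : (0 : R) < t%:R by have := tR; lra.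
have sq z : 2 * z <= z ^+ 2 / t%:R + t%:R :> R.
  have -> : z ^+ 2 / t%:R + t%:R = (z ^+ 2 + t%:R ^+ 2) / t%:R by field; lra.
  by rewrite ler_pdivlMr //; have := sqr_ge0 (z - t%:R); nra.
have h1 := sq (a - b); have h2 := sq (b - a).
have e : (b - a) ^+ 2 = (a - b) ^+ 2 by ring.
rewrite e in h2; set s := (a - b) ^+ 2 / _ in h1 h2 *.
by rewrite le_min; apply/andP; split; lra.
Qed.

(** By [Ed_take_filter] it suffices that min(hits, t^2) has expectation at least (1 - 1/t) * t^2,
    which follows from the quadratic lower bound and the first two moments of the hits. *)
Lemma Ed_topk_lb O w : #|O| = k -> (forall u, 0 <= w u) ->
  (1 - t%:R^-1) * (t%:R ^+ 2 / k%:R) * (\sum_(u in O) w u) <=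
  Ed rate (fun d => \sum_(u <- take (t ^ 2) [seq x <- d | x \in O]) w u).
Proof.
have aux (u v b T : R) : T != 0 -> (u + b) / 2 - (v / T + T) / 4 =
    1 / 2 * u + (- T^-1 / 4 * v + (b / 2 - T / 4)) by move=> T0; field.
move=> Ok w0; rewrite Ed_take_filter ?Ok //.
have W0 : 0 <= \sum_(u in O) w u by apply: sumr_ge0.
set W := \sum_(u in O) w u in W0 *.
set E := Ed _ _.
suff Elb : (1 - t%:R^-1) * t%:R ^+ 2 <= E.
  have -> : (1 - t%:R^-1) * (t%:R ^+ 2 / k%:R) * W =
     (W / k%:R) * ((1 - t%:R^-1) * t%:R ^+ 2) by ring.
  by rewrite ler_wpM2l // divr_ge0 // ltW.
have t0 : (0 : R) < t%:R by have := tR; lra.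
set mu : R := rate%:R * (k%:R / n%:R).
have mu1 : mu <= t%:R ^+ 2.
  by rewrite /mu mulrA ler_pdivrMr // rate_ub.
have mu2 : t%:R ^+ 2 - 1 <= mu.
  by rewrite /mu mulrA ler_pdivlMr //; have := rate_lb; lra.
set b : R := t%:R ^+ 2 in mu1 mu2 *.
have E1 : (mu + b) / 2 -
    ((mu * (1 - k%:R / n%:R) + (mu - b) ^+ 2) / t%:R + t%:R) / 4 <= E.
  have -> : mu * (1 - k%:R / n%:R) + (mu - b) ^+ 2 =
      Ed rate (fun d => (hits O d - b) ^+ 2) by rewrite Ed_hits_var Ok.
  have -> : mu = Ed rate (hits O) by rewrite Ed_hits Ok.
  rewrite aux ?lt0r_neq0 //.
  rewrite -[X in _ + (_ + X)](Ed_cst rate _ n0) -!EdZ -!EdD.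
  apply: Ed_le => s _; apply: le_trans (minn_quadratic _).
  by rewrite /hits -/b aux ?lt0r_neq0.
by apply: mean_var_arith mu1 mu2 E1 => //; rewrite divr_ge0 // ltW.
Qed.

End Rate.
End Sampling.

(** * Random greedy *)

(** The proof passes to the subtype of elements of [s], where the two relations are equal as
    functions. It lets sorting by the queried table replace sorting by true gains. *)
Lemma eq_in_sort (T : eqType) (r1 r2 : rel T) (s : seq T) :
  {in s &, r1 =2 r2} -> sort r1 s = sort r2 s.
Proof.
move=> r12; pose P := [pred x | x \in s].
have PP x y : P x -> P y -> r1 x y = r2 x y by apply: r12.
have : all P s by apply/allP.
clearbody P; move: PP => {r12} r12 /all_sigP[s' ->].
rewrite !sort_map; congr (map _ (sort _ _)).
apply/funext => -[x px]; apply/funext => -[y py].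
exact: r12.
Qed.

Lemma mean_addl (R : realType) (T : Type) (s : seq T) (a : R) g :
  (0 < size s)%N -> mean s (fun x => a + g x) = a + mean s g.
Proof.
rewrite -(ltr0n R) => s0; rewrite /mean big_split /= big_const_seq count_predT.
by rewrite iter_addr_0 -[a *+ _]mulr_natl mulrDr mulKf ?lt0r_neq0.
Qed.

Lemma disjoint_setUl (T : finType) (A B C : {set T}) :
  [disjoint A :|: B & C] = [disjoint A & C] && [disjoint B & C].
Proof. by rewrite -!setI_eq0 setIUl setU_eq0. Qed.

Lemma exists_superset n k (X : {set 'I_n}) : (k <= n)%N -> (#|X| <= k)%N ->
  exists2 O : {set 'I_n}, X \subset O & #|O| = k.
Proof.
move=> kn; elim: {X}(k - #|X|)%N {-2}X (erefl (k - #|X|)%N) => [|m IH] X e Xk.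
  by exists X => //; apply/eqP; rewrite eqn_leq Xk -subn_eq0 e.
have : (0 < #|~: X|)%N by rewrite -(leq_add2l #|X|) cardsC card_ord; lia.
case/card_gt0P => x; rewrite inE => xX.
have cX : #|x |: X| = #|X|.+1 by rewrite cardsU1 xX.
case: (IH (x |: X)); rewrite ?cX; [lia|lia|].
by move=> O sO Ok; exists O => //; apply: subset_trans sO; apply: subsetUr.
Qed.

Section TopSum.
Variables (R : realType) (T : eqType) (w : T -> R).
Hypothesis w0 : forall x, 0 <= w x.
Let geq_w := fun x y => w y <= w x.

(** In a decreasing list the head dominates the head of any subsequence, and induction handles the
    tails. *)
Lemma subseq_sum_take_sorted c s s' : sorted geq_w s -> subseq s' s ->
  (size s' <= c)%N -> \sum_(x <- s') w x <= \sum_(x <- take c s) w x.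
Proof.
have tr : transitive geq_w by move=> y x z xy yz; apply: le_trans yz xy.
elim: s c s' => [|x s IH] [|c] [|y s'] //=; rewrite ?big_nil ?sumr_ge0 //.
move=> xs ss' sc; rewrite !big_cons lerD //.
  have : y \in x :: s.
    by apply: (@mem_subseq _ (y :: s')); rewrite ?mem_head.
  rewrite inE => /predU1P[->//|ys].
  by have /allP := order_path_min tr xs; apply.
apply: IH => //; first exact: path_sorted xs.
case: eqVneq ss' => // _ /(subseq_trans _); apply; exact: subseq_cons.
Qed.

Lemma subseq_sum_take_sort c d s' : subseq s' d -> (size s' <= c)%N ->
  \sum_(x <- s') w x <= \sum_(x <- take c (sort geq_w d)) w x.
Proof.
have tr : transitive geq_w by move=> y x z xy yz; apply: le_trans yz xy.
have tot : total geq_w by move=> x y; apply: le_total.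
move=> sd sc; rewrite -[X in X <= _](perm_big _ (permEl (perm_sort geq_w s'))) /=.
apply: subseq_sum_take_sorted; rewrite ?sort_sorted ?subseq_sort ?size_sort //.
Qed.

End TopSum.

Section Greedy.
Variables (R : realType) (n k t : nat).
Hypotheses (k0 : (0 < k)%N) (kn : (k <= n)%N) (t2 : (2 <= t)%N).
Implicit Types (f G H : {set 'I_n} -> R) (A B Y Z O X : {set 'I_n}).

Let n0 : (0 < n)%N. Proof. exact: leq_trans kn. Qed.
Let kR : (0 : R) < k%:R. Proof. by rewrite ltr0n. Qed.
Let nR : (0 : R) < n%:R. Proof. by rewrite ltr0n. Qed.
Let tR : (0 : R) < t%:R. Proof. by rewrite ltr0n ltnW. Qed.
Let epsR : (0 : R) <= 1 - t%:R^-1.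
Proof. by rewrite subr_ge0 invf_le1 // ler1n ltnW. Qed.

(** Elements of [Y] and harmful elements get gain 0; they act as dummies that may be drawn and
    selected but leave [A] unchanged. *)
Definition gain f Y A (x : 'I_n) : R :=
  if x \in Y then 0 else Num.max 0 (f (x |: A) - f A).

Definition top f Y A (d : seq 'I_n) : seq 'I_n :=
  take (t ^ 2) (sort (fun x y => gain f Y A y <= gain f Y A x) d).

Definition augment f Y A (x : 'I_n) : {set 'I_n} :=
  if 0 < gain f Y A x then x |: A else A.

Definition gstep Y A : oalg R n :=
  draw (rate n k t) (fun d => queries (A :: [seq x |: A | x <- d])
    (fun g => unif (top g Y A d) (fun x => Ret R (augment g Y A x)))).

Lemma gain_ge0 f Y A x : 0 <= gain f Y A x.
Proof. by rewrite /gain; case: ifP; rewrite // le_max lexx. Qed.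

Lemma gain_tab f Y A d x : x \in d ->
  gain (tab f (A :: [seq x |: A | x <- d])) Y A x = gain f Y A x.
Proof.
move=> xd; rewrite /gain !tabE ?mem_head // inE.
by rewrite (map_f (fun x => x |: A)) ?orbT.
Qed.

Lemma top_tab f Y A d :
  top (tab f (A :: [seq x |: A | x <- d])) Y A d = top f Y A d.
Proof.
congr take; apply: eq_in_sort => x y xd yd.
by rewrite !gain_tab.
Qed.

Lemma mem_top f Y A d x : x \in top f Y A d -> x \in d.
Proof. by move/mem_take; rewrite mem_sort. Qed.

Lemma size_top f Y A d : size d = rate n k t -> size (top f Y A d) = (t ^ 2)%N.
Proof.
by move=> sd; rewrite size_takel // size_sort sd rate_ge.
Qed.

Lemma Ev_gstep f G Y A : Ev f G (gstep Y A) =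
  Ed (rate n k t) (fun d => mean (top f Y A d) (fun x => G (augment f Y A x))).
Proof.
rewrite Ev_draw //; apply: eq_Ed => d sd; rewrite Ev_queries top_tab Ev_unif.
  rewrite /mean; congr (_ * _); apply: eq_big_seq => x /mem_top xd /=.
  by rewrite /augment gain_tab.
by rewrite size_top // expn_gt0 ltnW.
Qed.

Lemma leaves_gstep f (P : {set 'I_n} -> Prop) Y A : P set0 -> P A ->
  (forall x, x \notin Y -> x \notin A -> P (x |: A)) -> leaves f P (gstep Y A).
Proof.
move=> P0 PA Px; apply: leaves_draw => // d sd.
apply: leaves_queries; apply: leaves_unif => // x; rewrite top_tab => /mem_top xd /=.
rewrite /augment gain_tab // /gain.
have [xY|xY] := boolP (x \in Y); first by rewrite ltxx.
have [xA|xA] := boolP (x \in A); last by case: ifP => // _; apply: Px.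
have /setUidPr -> : [set x] \subset A by rewrite sub1set.
by case: ifP.
Qed.

Lemma num_queries_gstep f Y A :
  (num_queries f (gstep Y A) <= (rate n k t).+1)%N.
Proof.
apply: num_queries_draw => d sd; rewrite num_queries_queries /= size_map sd.
by rewrite addSn ltnS -[leqRHS]addn0 leq_add2l; apply: num_queries_unif.
Qed.

(** The t^2 best samples have at least the total gain of any t^2 samples lying in [O]; [Ed_topk_lb]
    bounds the latter, and the uniform choice divides by t^2. *)
Lemma gstep_gain f Y A O : #|O| = k ->
  f A + (1 - t%:R^-1) / k%:R * \sum_(o in O) gain f Y A o <= Ev f f (gstep Y A).
Proof.
move=> Ok; rewrite Ev_gstep.
have tt : (0 : R) < (t ^ 2)%:R by rewrite ltr0n expn_gt0 ltnW.
pose Q d := \sum_(u <- take (t ^ 2) [seq x <- d | x \in O]) gain f Y A u.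
apply: (@le_trans _ _ (f A + (t ^ 2)%:R^-1 * Ed (rate n k t) Q)).
  rewrite lerD2l ler_pdivlMl //.
  have := @Ed_topk_lb R n n0 k t k0 kn t2 O (gain f Y A) Ok (gain_ge0 f Y A).
  apply: le_trans; rewrite natrX le_eqVlt; apply/orP; left; apply/eqP.
  by ring.
rewrite -EdZ -[X in X + _](Ed_cst (rate n k t) (f A) n0) -EdD; apply: Ed_le => d sd.
have augE x : f (augment f Y A x) = f A + gain f Y A x.
  rewrite /augment /gain; have [xY|xY] := boolP (x \in Y).
    by rewrite ltxx addr0.
  by rewrite lt_max ltxx /=; case: ltP => ?; lra.
rewrite /mean; under [in leRHS]eq_bigr do rewrite augE.
rewrite -/(mean _ (fun x => f A + gain f Y A x)) mean_addl ?size_top ?expn_gt0 1?ltnW //.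
rewrite lerD2l /mean size_top // ler_pM2l ?invr_gt0 //.
apply: subseq_sum_take_sort; first exact: gain_ge0.
  exact: subseq_trans (take_subseq _ _) (filter_subseq _ _).
by rewrite size_take_min geq_minl.
Qed.

(** As [psi] is nonpositive, the sum over the selected candidates may be enlarged to the whole
    sample, whose expectation is rate/n times the full sum. *)
Lemma gstep_drift f H Y A (psi : 'I_n -> R) : (forall u, psi u <= 0) ->
  (forall u, u \notin Y -> psi u <= H (u |: A) - H A) ->
  H A + k%:R^-1 * \sum_u psi u <= Ev f H (gstep Y A).
Proof.
move=> psi0 psiH; rewrite Ev_gstep.
have tt : (0 : R) < (t ^ 2)%:R by rewrite ltr0n expn_gt0 ltnW.
have S0 : \sum_u psi u <= 0 by rewrite sumr_le0.
apply: (@le_trans _ _ (H A + (t ^ 2)%:R^-1 *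
    Ed (rate n k t) (fun d => \sum_(x <- d) psi x))).
  rewrite lerD2l Ed_sum // mulrA ler_wnM2r //.
  rewrite ler_pdivrMl // ler_pdivrMr // mulrAC ler_pdivlMr //.
  by rewrite natrX; apply: rate_ub.
rewrite -EdZ -[X in X + _](Ed_cst (rate n k t) (H A) n0) -EdD; apply: Ed_le => d sd.
have augE x : H A + psi x <= H (augment f Y A x).
  rewrite /augment /gain; have [xY|xY] := boolP (x \in Y).
    by rewrite ltxx gerDl.
  by case: ifP => _; [have := psiH _ xY; lra|rewrite gerDl].
apply: (@le_trans _ _ (mean (top f Y A d) (fun x => H A + psi x))); last first.
  by rewrite /mean ler_wpM2l ?invr_ge0 ?ler0n //; apply: ler_sum.
rewrite mean_addl ?size_top ?expn_gt0 1?ltnW // lerD2l /mean size_top //.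
rewrite ler_pM2l ?invr_gt0 //.
rewrite -(perm_big _ (permEl (perm_sort (fun x y => gain f Y A y <= gain f Y A x) d))).
rewrite -[X in \sum_(_ <- X) _ <= _](cat_take_drop (t ^ 2)) big_cat /=.
by rewrite gerDl sumr_le0.
Qed.

Let q : R := 1 - k%:R^-1.

Let q0 : 0 <= q. Proof. by rewrite subr_ge0 invf_le1 // ler1n. Qed.

Section Analysis.
Variable f : {set 'I_n} -> R.
Hypotheses (f0 : nonnegative f) (sf : submodular f).

(** [X] is padded to a set of size exactly [k], which costs nothing since gains are nonnegative. The
    factor of [f A] is really 1 - (1 - 1/t)/k, and it is relaxed to [q] by nonnegativity of [f]. *)
Lemma gstep_value X Y A : (#|X| <= k)%N -> [disjoint X & Y] ->
  q * f A + (1 - t%:R^-1) / k%:R * f (X :|: A) <= Ev f f (gstep Y A).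
Proof.
move=> Xk XY; have [O XO Ok] := exists_superset kn Xk.
apply: le_trans (gstep_gain f Y A Ok).
have S : f (X :|: A) - f A <= \sum_(o in O) gain f Y A o.
  apply: le_trans (submodular_sum A X sf) _.
  rewrite [leRHS](big_setID X) /= (setIidPr XO) -[leLHS]addr0.
  rewrite lerD ?sumr_ge0 //; last by move=> u _; apply: gain_ge0.
  apply: ler_sum => u uX; rewrite /gain (disjointFr XY uX).
  by rewrite le_max lexx orbT.
have c0 : 0 <= (1 - t%:R^-1) / k%:R :> R by rewrite divr_ge0 // ltW.
have c1 : (1 - t%:R^-1) / k%:R <= k%:R^-1 :> R.
  by rewrite ler_piMl ?invr_ge0 ?ler0n // gerBl invr_ge0 ler0n.
have := ler_wpM2l c0 S; have := f0 A; rewrite /q.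
move: ((1 - t%:R^-1) / k%:R) c0 c1 => c; move: (k%:R^-1) => e c0 c1 fA.
nra.
Qed.

(** Only the elements of [N], whose insertion lowers [H], can hurt. Their losses sum to at most the
    loss from inserting all of [N] at once, and N :|: A still avoids [Y], so the bound [l]
    applies. *)
Lemma gstep_union X Y A (l : R) : [disjoint A & Y] ->
  (forall B, [disjoint B & Y] -> l <= f (X :|: B)) ->
  q * f (X :|: A) + k%:R^-1 * l <= Ev f (fun B => f (X :|: B)) (gstep Y A).
Proof.
move=> AY fl; pose H B := f (X :|: B); rewrite -/(H A).
pose N := [set u | (u \notin Y) && (H (u |: A) < H A)].
pose psi u := if u \in N then H (u |: A) - H A else 0.
apply: le_trans (@gstep_drift f H Y A psi _ _); last first.
- by move=> u uY; rewrite /psi inE uY /=; case: ltP => //; rewrite subr_ge0.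
- by move=> u; rewrite /psi inE; case: ifP => // /andP[_]; rewrite subr_le0 => /ltW.
rewrite /q mulrBl mul1r -addrA lerD2l -mulrN -mulrDr ler_pM2l ?invr_gt0 //.
rewrite addrC /psi -big_mkcond /=.
apply: le_trans (_ : f (N :|: (X :|: A)) - f (X :|: A) <= _).
  rewrite lerD2r // setUCA; apply: fl.
  rewrite disjoint_setUl AY andbT disjoint_subset; apply/subsetP => u.
  by rewrite !inE => /andP[].
apply: le_trans (submodular_sum _ _ sf) _.
by apply: ler_sum => u _; rewrite /H setUCA.
Qed.

Fixpoint giter Y i A : oalg R n :=
  if i is j.+1 then bind (giter Y j A) (gstep Y) else Ret R A.

Lemma giter_disjoint Y i A : [disjoint A & Y] ->
  leaves f (fun B => [disjoint B & Y] : Prop) (giter Y i A).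
Proof.
move=> AY; elim: i => //= i IH; apply: leaves_bind; apply: leaves_impl IH => B BY.
apply: leaves_gstep => // [|x xY _]; first by rewrite disjoints_subset sub0set.
by rewrite disjoint_setUl BY disjoints1 xY.
Qed.

Lemma giter_card Y i A :
  leaves f (fun B => (#|B| <= #|A| + i)%N : Prop) (giter Y i A).
Proof.
elim: i => [|i IH] /=; first by rewrite addn0.
apply: leaves_bind; apply: leaves_impl IH => B BA.
apply: leaves_gstep => [||x _ xB]; first by rewrite cards0.
  by rewrite addnS leqW.
by rewrite cardsU1 xB add1n addnS ltnS.
Qed.

Lemma num_queries_giter Y i A :
  (num_queries f (giter Y i A) <= i * (rate n k t).+1)%N.
Proof.
elim: i => [//|i IH] /=; rewrite mulSn addnC.
apply: leq_trans (_ : _ <= num_queries f (giter Y i A) + (rate n k t).+1)%N _.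
  apply: num_queries_bind; apply: leaves_impl (leaves_true f _) => B _.
  exact: num_queries_gstep.
by rewrite leq_add2r.
Qed.

Section Phase.
Variables (X Y A : {set 'I_n}) (l : R).
Hypotheses (AY : [disjoint A & Y]).
Hypothesis fl : forall B, [disjoint B & Y] -> l <= f (X :|: B).

(** The one-step bound is an affine recurrence with fixed point [l] and contraction factor [q]. *)
Lemma giter_union i :
  l + q ^+ i * (f (X :|: A) - l) <= Ev f (fun B => f (X :|: B)) (giter Y i A).
Proof.
elim: i => [|i IH] /=; first by rewrite expr0 mul1r addrC subrK.
rewrite Ev_bind; apply: le_trans (_ : Ev f (fun B => q * f (X :|: B) + k%:R^-1 * l)
   (giter Y i A) <= _); last first.
  by apply: ler_Ev (giter_disjoint i AY) _ => B BY; apply: gstep_union.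
rewrite EvD EvZ Ev_cst exprS; have := ler_wpM2l q0 IH.
by rewrite /q; move: (k%:R^-1) => e; set z := (1 - e) ^+ i; nra.
Qed.

(** The recurrence for the value has factor [q] and a source decaying like q^i by [giter_union];
    this resonance produces the term i/k * q^(i-1). *)
Lemma giter_value i : (#|X| <= k)%N -> [disjoint X & Y] ->
  q ^+ i * f A + (1 - t%:R^-1) * ((1 - q ^+ i) * l +
    i%:R / k%:R * q ^+ i.-1 * (f (X :|: A) - l)) <= Ev f f (giter Y i A).
Proof.
move=> Xk XY; elim: i => [|i IH].
  by rewrite /= expr0 mul0r !mul0r subrr mul0r addr0 mulr0 addr0 mul1r.
rewrite [leRHS]/= Ev_bind.
apply: le_trans (_ : Ev f (fun B => q * f B + (1 - t%:R^-1) / k%:R * f (X :|: B))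
   (giter Y i A) <= _); last first.
  by apply: ler_Ev (leaves_true f _) _ => B _; apply: gstep_value.
rewrite EvD !EvZ; have c0 : 0 <= (1 - t%:R^-1) / k%:R :> R by rewrite divr_ge0 // ltW.
have := lerD (ler_wpM2l q0 IH) (ler_wpM2l c0 (giter_union i)).
apply: le_trans; rewrite le_eqVlt; apply/orP; left; apply/eqP.
have -> : i.+1%:R / k%:R * q ^+ i.+1.-1 =
    q * (i%:R / k%:R * q ^+ i.-1) + k%:R^-1 * q ^+ i.
  case: i {IH} => [|i] /=; first by rewrite mul0r !mul0r mulr0 add0r mul1r.
  by rewrite exprS -[i.+2%:R]natr1; ring.
rewrite exprS; set z := q ^+ i; set y := i%:R / _ * _.
rewrite /q; move: (k%:R^-1) (t%:R^-1) => e d; ring.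
Qed.

End Phase.

Lemma greedy_value Z O s P Q : (#|O| <= k)%N -> (s <= k)%N ->
  P = q ^+ (k - s) - q ^+ k ->
  Q = (k - s)%:R / k%:R * q ^+ (k - s).-1 ->
  (1 - t%:R^-1) * ((P + Q) * f O - P * f (Z :&: O)
    - (P + Q - q ^+ k.-1) * f (Z :|: O)) <=
  Ev f f (bind (giter Z s set0) (giter set0 (k - s))).
Proof.
move=> Ok sk PE QE; rewrite Ev_bind.
pose u := f (Z :|: O); pose v := f (Z :&: O).
have d0 (B : {set 'I_n}) : [disjoint B & set0] by rewrite -setI_eq0 setI0.
have d0' (B : {set 'I_n}) : [disjoint set0 & B] by rewrite -setI_eq0 set0I.
(* For [B] avoiding [Z], the sets X :|: B and X :|: Z meet exactly in [X], so submodularity and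
   nonnegativity give the lower bound used as [l]. *)
have outer X B : [disjoint B & Z] -> f X - f (X :|: Z) <= f (X :|: B).
  move=> BZ; have := submodularUI (X :|: B) (X :|: Z) sf.
  rewrite -setUIr (_ : B :&: Z = set0) ?setU0; last by apply/eqP; rewrite setI_eq0.
  by have := f0 (X :|: B :|: (X :|: Z)); lra.
have F1 := @giter_value (O :\: Z) Z set0 _ (d0' Z) (@outer _) s.
have H1 := @giter_union O Z set0 _ (d0' Z) (@outer _) s.
apply: le_trans (_ : Ev f (fun B => q ^+ (k - s) * f B + (1 - t%:R^-1) *
   ((k - s)%:R / k%:R * q ^+ (k - s).-1) * f (O :|: B)) (giter Z s set0) <= _); last first.
  apply: ler_Ev (leaves_true f _) _ => B _.
  have := @giter_value O set0 B 0 (d0 B) (fun C _ => f0 _) (k - s) Ok (d0 O).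
  by rewrite mulr0 add0r subr0 !mulrA.
rewrite EvD !EvZ -QE.
have {}F1 : (1 - t%:R^-1) * ((1 - q ^+ s) * (f O - v - u) + s%:R / k%:R * q ^+ s.-1 * u)
    <= Ev f f (giter Z s set0).
  apply: le_trans (F1 _ _); last first.
  - by rewrite -setI_eq0 setDE -setIA [~: Z :&: Z]setIC setICr setI0.
  - by apply: leq_trans Ok; apply: subset_leq_card; apply: subsetDl.
  have uE : O :\: Z :|: Z = Z :|: O.
    by apply/setP => x; rewrite !inE; case: (x \in Z); rewrite ?orbF.
  have aE : f O - v <= f (O :\: Z).
    have := submodularUI (Z :&: O) (O :\: Z) sf.
    rewrite [Z :&: O]setIC setID [O :&: Z]setIC -/v.
    by have := f0 (Z :&: O :&: (O :\: Z)); lra.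
  rewrite setU0 uE -/u opprB addrCA subrr addr0.
  have h : 0 <= q ^+ s <= 1.
    by rewrite exprn_ge0 // exprn_ile1 // gerBl invr_ge0 ler0n.
  have qA : 0 <= q ^+ s * f set0 by rewrite mulr_ge0 ?f0 //; case/andP: h.
  rewrite -[leLHS]add0r lerD // ler_wpM2l // lerD2r ler_wpM2l //; lra.
have {}H1 : f O - (1 - q ^+ s) * u <= Ev f (fun B => f (O :|: B)) (giter Z s set0).
  by apply: le_trans H1; rewrite setU0 [O :|: Z]setUC -/u; lra.
have Q0 : 0 <= (1 - t%:R^-1) * Q.
  by rewrite mulr_ge0 // QE mulr_ge0 ?exprn_ge0 // divr_ge0 // ler0n.
have q1 : 0 <= q ^+ (k - s) by rewrite exprn_ge0.
have := lerD (ler_wpM2l q1 F1) (ler_wpM2l Q0 H1).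
apply: le_trans; rewrite le_eqVlt; apply/orP; left; apply/eqP.
have kE : q ^+ k = q ^+ (k - s) * q ^+ s by rewrite -exprD subnK.
have k1E : s%:R / k%:R * q ^+ k.-1 =
    s%:R / k%:R * (q ^+ (k - s) * q ^+ s.-1).
  by case: (s) sk => [|j] jk; rewrite ?mul0r // -exprD; congr (_ * q ^+ _); lia.
have QsE : Q * q ^+ s = (k - s)%:R / k%:R * q ^+ k.-1.
  rewrite QE -mulrA -exprD; case: (ltnP s k) => sk'.
    by congr (_ * q ^+ _); lia.
  by rewrite (eqP (_ : (k - s)%N == 0%N)) ?mul0r // subn_eq0.
have sE : s%:R / k%:R + (k - s)%:R / k%:R = 1 :> R.
  by rewrite -mulrDl -natrD subnKC // divff ?lt0r_neq0.
(* Splitting q^(k-1) by the weights s/k and (k-s)/k combines the f(Z :|: O) terms of both phases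
   into the single coefficient q^(k-1). *)
have e1 : q ^+ k.-1 = s%:R / k%:R * (q ^+ (k - s) * q ^+ s.-1) + Q * q ^+ s.
  by rewrite QsE -k1E -mulrDl sE mul1r.
rewrite PE e1 kE -/u -/v.
move: (q ^+ (k - s)) (q ^+ s) (q ^+ s.-1) (s%:R / k%:R) (t%:R^-1) (f O) => a b c d e g.
by clearbody u v; ring.
Qed.

End Analysis.
End Greedy.

(** * Local search *)

Section LocalSearch.
Variables (R : realType) (n k t : nat).
Hypotheses (k0 : (0 < k)%N) (kn : (k <= n)%N) (t2 : (2 <= t)%N).
Implicit Types (f g : {set 'I_n} -> R) (Z O : {set 'I_n}).
Implicit Types (d : seq 'I_n) (p : option 'I_n * option 'I_n).

Let n0 : (0 < n)%N. Proof. exact: leq_trans kn. Qed.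
Let kR : (0 : R) < k%:R. Proof. by rewrite ltr0n. Qed.
Let tR : (0 : R) < t%:R. Proof. by rewrite ltr0n ltnW. Qed.
Let epsR : (0 : R) <= 1 - t%:R^-1.
Proof. by rewrite subr_ge0 invf_le1 // ler1n ltnW. Qed.

(* A move (uo, vo) removes uo from Z and inserts vo, where None means that
   nothing is removed, respectively inserted. *)
Definition move_set Z p : {set 'I_n} :=
  [set x | Some x == p.2] :|: (Z :\: [set x | Some x == p.1]).

Definition feasible Z d p : bool :=
  [&& if p.1 is Some u then u \in Z else true,
      if p.2 is Some v then (v \in d) && (v \notin Z) else true &
      (#|move_set Z p| <= k)%N].

Definition delG g Z uo : R := if uo is Some u then g (Z :\ u) - g Z else 0.
Definition insG g Z vo : R := if vo is Some v then g (v |: Z) - g Z else 0.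

(* By submodularity this is a lower bound on the gain of the move, and it only
   needs the values of f at single deletions and single insertions. *)
Definition estimate g Z p : R := delG g Z p.1 + insG g Z p.2.

Definition best_move g Z d :=
  [arg max_(p > (None, None) | feasible Z d p) estimate g Z p]%O.

(** Swapped sets are never queried: a step costs rate + k + 1 queries rather than about rate * k, so
    L * k steps stay within O(n + k^2). *)
Definition probes Z d : seq {set 'I_n} :=
  Z :: [seq x |: Z | x <- d] ++ [seq Z :\ x | x <- enum Z].

Definition lstep Z : oalg R n :=
  draw (rate n k t) (fun d => queries (probes Z d)
    (fun g => Ret R (move_set Z (best_move g Z d)))).

Lemma move_set_None Z : move_set Z (None, None) = Z.
Proof. by apply/setP => x; rewrite !inE. Qed.

Lemma move_set_del Z u : move_set Z (Some u, None) = Z :\ u.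
Proof. by apply/setP => x; rewrite !inE. Qed.

Lemma move_set_ins Z v : move_set Z (None, Some v) = v |: Z.
Proof. by apply/setP => x; rewrite !inE. Qed.

Lemma move_set_swap Z u v : move_set Z (Some u, Some v) = v |: Z :\ u.
Proof. by apply/setP => x; rewrite !inE. Qed.

Lemma feasible_None Z d : (#|Z| <= k)%N -> feasible Z d (None, None).
Proof. by move=> Zk; rewrite /feasible /= move_set_None. Qed.

Lemma estimate_tab f Z d p : feasible Z d p ->
  estimate (tab f (probes Z d)) Z p = estimate f Z p.
Proof.
have: Z \in probes Z d by rewrite mem_head.
have: forall u, u \in Z -> Z :\ u \in probes Z d.
  move=> u uZ; rewrite inE mem_cat (map_f (fun x => Z :\ x)) ?orbT //.
  by rewrite mem_enum.
have: forall v, v \in d -> v |: Z \in probes Z d.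
  by move=> v vd; rewrite inE mem_cat (map_f (fun x => x |: Z)) ?orbT.
move: (probes Z d) => S ins del self.
case: p => [uo vo] /and3P[/= hu hv _]; rewrite /estimate; congr (_ + _).
  by case: uo hu => //= u uZ; rewrite !tabE ?del.
by case: vo hv => //= v /andP[vd _]; rewrite !tabE ?ins.
Qed.

Lemma best_moveP f Z d : (#|Z| <= k)%N ->
  let p := best_move (tab f (probes Z d)) Z d in
  feasible Z d p /\ forall p', feasible Z d p' -> estimate f Z p' <= estimate f Z p.
Proof.
move=> Zk /=; rewrite /best_move.
case: (Order.TotalTheory.arg_maxP (estimate (tab f (probes Z d)) Z) (feasible_None d Zk)).
move=> p fp max; split=> // p' fp'.
by rewrite -(estimate_tab f fp) -(estimate_tab f fp'); apply: max.
Qed.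

(** For a swap, inserting [v] after deleting [u] gains at least as much as inserting it into [Z]. *)
Lemma estimate_le f Z d p : submodular f -> feasible Z d p ->
  estimate f Z p <= f (move_set Z p) - f Z.
Proof.
move=> sf; case: p => [[u|] [v|]] /and3P[/= uZ vZ _]; rewrite /estimate /=.
- rewrite move_set_swap; case/andP: vZ => _ vZ.
  by have := sf (Z :\ u) Z v (subsetDl _ _) vZ; lra.
- by rewrite move_set_del addr0.
- by rewrite move_set_ins add0r.
- by rewrite move_set_None addr0 subrr.
Qed.

Lemma leaves_lstep f Z : (#|Z| <= k)%N ->
  leaves f (fun B => (#|B| <= k)%N : Prop) (lstep Z).
Proof.
move=> Zk; apply: leaves_draw; rewrite ?cards0 // => d _.
apply: leaves_queries => /=.
by case: (best_moveP f d Zk) => /and3P[].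
Qed.

Lemma num_queries_lstep f Z : (#|Z| <= k)%N ->
  (num_queries f (lstep Z) <= (rate n k t + k).+1)%N.
Proof.
move=> Zk; apply: num_queries_draw => d sd.
rewrite num_queries_queries addn0 /= ltnS size_cat !size_map sd leq_add2l.
by rewrite -cardE.
Qed.

Section Improvement.
Variable f : {set 'I_n} -> R.
Hypotheses (f0 : nonnegative f) (sf : submodular f).

Definition lgain Z d : R := f (move_set Z (best_move (tab f (probes Z d)) Z d)) - f Z.

Lemma Ev_lstep Z : Ev f f (lstep Z) = f Z + Ed (rate n k t) (lgain Z).
Proof.
rewrite Ev_draw // -[X in X + _](Ed_cst (rate n k t) (f Z) n0) -EdD.
by apply: eq_Ed => d _; rewrite Ev_queries /= /lgain addrC subrK.
Qed.

Lemma lgain_ge Z d p : (#|Z| <= k)%N -> feasible Z d p ->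
  estimate f Z p <= lgain Z d.
Proof.
move=> Zk fp; have [fb max] := best_moveP f d Zk.
exact: le_trans (max _ fp) (estimate_le sf fb).
Qed.

Lemma lgain_ge0 Z d : (#|Z| <= k)%N -> 0 <= lgain Z d.
Proof.
move=> Zk; apply: le_trans (lgain_ge Zk (feasible_None d Zk)).
by rewrite /estimate addr0.
Qed.

Lemma lgain_del Z d u : (#|Z| <= k)%N -> u \in Z -> f (Z :\ u) - f Z <= lgain Z d.
Proof.
move=> Zk uZ; apply: le_trans (lgain_ge (p := (Some u, None)) Zk _).
  by rewrite /estimate /= addr0.
rewrite /feasible /= uZ move_set_del (leq_trans _ Zk) //.
by apply: subset_leq_card; apply: subsetDl.
Qed.

(** The deletion [uo] is fixed and the insertion is sampled. At most t^2 samples in a superset of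
    [O] of size [k] are counted, and the best move does at least as well as each of them. *)
Lemma Ed_lgain_ge Z O uo (a : R) : (#|Z| <= k)%N -> (#|O| <= k)%N ->
  (forall d v, v \in d -> v \notin Z -> feasible Z d (uo, Some v)) ->
  a = delG f Z uo ->
  (1 - t%:R^-1) / k%:R * \sum_(v in O :\: Z) (f (v |: Z) - f Z + a) <=
  Ed (rate n k t) (lgain Z).
Proof.
move=> Zk Ok feas aE.
pose w v := if v \in Z then 0 else Num.max 0 (f (v |: Z) - f Z + a).
have w0 v : 0 <= w v by rewrite /w; case: ifP => // _; rewrite le_max lexx.
have [O' OO' O'k] := exists_superset kn Ok.
have tt : (0 : R) < t%:R ^+ 2 by rewrite exprn_gt0.
have := @Ed_topk_lb R n n0 k t k0 kn t2 O' w O'k w0.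
set U := Ed _ _ => lbU.
have UE : U <= t%:R ^+ 2 * Ed (rate n k t) (lgain Z).
  rewrite -EdZ; apply: Ed_le => d sd.
  have g0 := lgain_ge0 d Zk.
  set s := take _ _.
  apply: (@le_trans _ _ (\sum_(v <- s) lgain Z d)).
    rewrite big_seq [leRHS]big_seq; apply: ler_sum => v /mem_take.
    rewrite mem_filter => /andP[_ vd]; rewrite /w; case: ifPn => // vZ.
    rewrite ge_max g0 /=; apply: le_trans (lgain_ge Zk (feas d v vd vZ)).
    by rewrite /estimate /= -aE addrC.
  rewrite big_const_seq count_predT iter_addr_0 -[_ *+ _]mulr_natl ler_wpM2r //.
  by rewrite -natrX ler_nat size_take_min geq_minl.
rewrite -(ler_pM2l tt); apply: le_trans UE; apply: le_trans lbU.
have S : \sum_(v in O :\: Z) (f (v |: Z) - f Z + a) <= \sum_(v in O') w v.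
  rewrite [leRHS](big_setID (O :\: Z)) /= -[leLHS]addr0.
  rewrite lerD ?sumr_ge0 // (setIidPr _); last first.
    by apply: subset_trans OO'; apply: subsetDl.
  apply: ler_sum => v; rewrite inE => /andP[vZ _].
  by rewrite /w (negbTE vZ) le_max lexx orbT.
have c0 : 0 <= (1 - t%:R^-1) * (t%:R ^+ 2 / k%:R) :> R.
  by rewrite mulr_ge0 // divr_ge0 // ltW.
apply: le_trans (ler_wpM2l c0 S); rewrite le_eqVlt; apply/orP; left; apply/eqP.
by move: (\sum_(v in _) _) (k%:R^-1) (t%:R^-1) => x y z; ring.
Qed.

(** [W] and [C] collect single insertions and deletions. If #|Z| < k, they are charged separately,
    each to k * E. If [Z] is full, every insertion is paired with the best deletion, and the surplus
    deletions are charged on their own. *)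
Lemma lstep_union_inter Z O : (#|Z| <= k)%N -> (#|O| <= k)%N ->
  f Z + (1 - t%:R^-1) / (2 * k%:R) * (f (Z :|: O) + f (Z :&: O) - 2 * f Z) <=
  Ev f f (lstep Z).
Proof.
move=> Zk Ok; rewrite Ev_lstep lerD2l; set E := Ed _ _.
pose W := \sum_(v in O :\: Z) (f (v |: Z) - f Z).
pose C := \sum_(u in Z :\: O) (f (Z :\ u) - f Z).
have hW : f (Z :|: O) - f Z <= W.
  have := submodular_sum Z (O :\: Z) sf.
  by rewrite (_ : O :\: Z :|: Z = Z :|: O) //;
    apply/setP => x; rewrite !inE; case: (x \in Z); rewrite ?orbF.
have hC : f (Z :&: O) - f Z <= C.
  have := submodular_sum_del Z (Z :\: O) sf.
  by rewrite setDDr setDv set0U.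
have E0 : 0 <= E.
  by rewrite -(Ed_cst (rate n k t) 0 n0); apply: Ed_le => d _; apply: lgain_ge0.
have Edel u : u \in Z -> f (Z :\ u) - f Z <= E.
  move=> uZ; rewrite -[leLHS](Ed_cst (rate n k t) _ n0).
  by apply: Ed_le => d _; apply: lgain_del.
have Cle a : (forall u, u \in Z :\: O -> f (Z :\ u) - f Z <= a) -> C <= #|Z :\: O|%:R * a.
  by move=> le_a; rewrite mulr_natl -sumr_const; apply: ler_sum.
have kE : 0 <= k%:R * E by rewrite mulr_ge0 // ltW.
have eps1 : 1 - t%:R^-1 <= 1 :> R by rewrite gerBl invr_ge0 ler0n.
suff main : (1 - t%:R^-1) * (W + C) <= 2 * (k%:R * E).
  have c0 : 0 <= (1 - t%:R^-1) / (2 * k%:R) :> R.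
    by rewrite divr_ge0 // mulr_ge0 // ltW.
  have WC : f (Z :|: O) + f (Z :&: O) - 2 * f Z <= W + C by lra.
  apply: le_trans (ler_wpM2l c0 WC) _.
  by rewrite mulrAC ler_pdivrMr ?mulr_gt0 //; lra.
(* [s] bounds the deletions, and [l * a] is the part of it already charged together with the
   insertions. *)
have WE (s l a : R) : (1 - t%:R^-1) / k%:R * (W + l * a) <= E ->
    C <= s -> s - l * a <= k%:R * E -> (1 - t%:R^-1) * (W + C) <= 2 * (k%:R * E).
  rewrite mulrAC ler_pdivrMr // [E * _]mulrC => h1 h2 h3.
  have := ler_wpM2l epsR h2; have := ler_wpM2l epsR h3.
  have := ler_wpM2r kE eps1; rewrite mul1r.
  move: (1 - t%:R^-1) (k%:R * E) h1 h3 => e x; nra.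
have [Zltk|Zgek] := ltnP #|Z| k.
  have := @Ed_lgain_ge Z O None 0 Zk Ok _ erefl; rewrite -/E.
  under eq_bigr do rewrite addr0.
  move=> h; apply: (@WE (k%:R * E) 0 0); rewrite ?mul0r ?addr0 ?subr0 //.
    apply: h => d v vd vZ; rewrite /feasible /= vd vZ move_set_ins.
    by rewrite cardsU1 vZ.
  apply: le_trans (Cle E _) _; last first.
    rewrite ler_wpM2r // ler_nat (leq_trans _ Zk) //.
    by rewrite subset_leq_card // subsetDl.
  by move=> u; rewrite inE => /andP[_]; apply: Edel.
have ZO : (#|O :\: Z| <= #|Z :\: O|)%N.
  rewrite -(leq_add2l #|O :&: Z|) cardsID setIC cardsID.
  by rewrite (leq_trans Ok).
(* If nothing can be deleted, the comparison of sizes also empties O :\: Z, and both sums vanish. *)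
have [e|[u0 u0Z]] := set_0Vmem (Z :\: O).
  have e' : O :\: Z = set0.
    by apply/eqP; rewrite -cards_eq0 -leqn0; move: ZO; rewrite e cards0.
  by rewrite /W /C e e' !big_set0 addr0 mulr0 mulr_ge0.
have [u uZO umax] := @Order.TotalTheory.arg_maxP _ _ _ u0
  (fun u => u \in Z :\: O) (fun u => f (Z :\ u) - f Z) u0Z.
have uZ : u \in Z by case/setDP: uZO.
set a := f (Z :\ u) - f Z in umax.
apply: (@WE (#|Z :\: O|%:R * a) #|O :\: Z|%:R a).
- rewrite mulr_natl -sumr_const -big_split /=.
  apply: (@Ed_lgain_ge Z O (Some u)) => // d v vd vZ.
  rewrite /feasible /= uZ vd vZ move_set_swap (leq_trans _ Zk) //.
  by rewrite cardsU1 [in leqRHS](cardsD1 u) uZ leq_add2r leq_b1.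
- by apply: Cle => v vZO; exact: umax vZO.
- rewrite -mulrBl -natrB //.
  apply: le_trans (_ : (#|Z :\: O| - #|O :\: Z|)%:R * E <= _).
    by rewrite ler_wpM2l ?ler0n // Edel.
  rewrite ler_wpM2r // ler_nat (leq_trans (leq_subr _ _)) // (leq_trans _ Zk) //.
  by rewrite subset_leq_card // subsetDl.
Qed.

Lemma lstep_inter Z O : (#|Z| <= k)%N ->
  f Z + (1 - t%:R^-1) / (2 * k%:R) * (f (Z :&: O) - f Z) <= Ev f f (lstep Z).
Proof.
move=> Zk; rewrite Ev_lstep lerD2l; set E := Ed _ _.
have hC : f (Z :&: O) - f Z <= \sum_(u in Z :\: O) (f (Z :\ u) - f Z).
  by have := submodular_sum_del Z (Z :\: O) sf; rewrite setDDr setDv set0U.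
have E0 : 0 <= E.
  by rewrite -(Ed_cst (rate n k t) 0 n0); apply: Ed_le => d _; apply: lgain_ge0.
have {}hC : f (Z :&: O) - f Z <= k%:R * E.
  apply: le_trans hC _; apply: (@le_trans _ _ (\sum_(u in Z :\: O) E)).
    apply: ler_sum => u; rewrite inE => /andP[_ uZ].
    rewrite -[leLHS](Ed_cst (rate n k t) _ n0).
    by apply: Ed_le => d _; apply: lgain_del.
  rewrite sumr_const -[_ *+ _]mulr_natl ler_wpM2r // ler_nat (leq_trans _ Zk) //.
  by rewrite subset_leq_card // subsetDl.
have eps1 : 1 - t%:R^-1 <= 1 :> R by rewrite gerBl invr_ge0 ler0n.
rewrite mulrAC ler_pdivrMr ?mulr_gt0 //.
have kE : 0 <= k%:R * E by rewrite mulr_ge0 // ltW.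
have := ler_wpM2l epsR hC; have := ler_wpM2r kE eps1; rewrite mul1r.
rewrite [E * _]mulrC -mulrA.
move: (1 - t%:R^-1) (k%:R * E) kE => e x; nra.
Qed.

Fixpoint liter i Z : oalg R n :=
  if i is j.+1 then bind (liter j Z) lstep else Ret R Z.

Lemma leaves_liter i Z : (#|Z| <= k)%N ->
  leaves f (fun B => (#|B| <= k)%N : Prop) (liter i Z).
Proof.
move=> Zk; elim: i => //= i IH; apply: leaves_bind; apply: leaves_impl IH => B Bk.
exact: leaves_lstep.
Qed.

Lemma num_queries_liter i Z : (#|Z| <= k)%N ->
  (num_queries f (liter i Z) <= i * (rate n k t + k).+1)%N.
Proof.
move=> Zk; elim: i => [//|i IH] /=; rewrite mulSn addnC.
apply: leq_trans (_ : _ <= num_queries f (liter i Z) + (rate n k t + k).+1)%N _.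
  apply: num_queries_bind; apply: leaves_impl (leaves_liter i Zk) => B Bk.
  exact: num_queries_lstep.
by rewrite leq_add2r.
Qed.

Definition local_search (T : nat) : oalg R n :=
  unif (iota 0 T) (fun i => liter i set0).

Lemma leaves_local_search T :
  leaves f (fun B => (#|B| <= k)%N : Prop) (local_search T).
Proof.
apply: leaves_unif; rewrite ?cards0 // => i _.
by apply: leaves_liter; rewrite cards0.
Qed.

Lemma num_queries_local_search T :
  (num_queries f (local_search T) <= T * (rate n k t + k).+1)%N.
Proof.
apply: num_queries_unif => i; rewrite mem_iota => /andP[_ iT].
apply: leq_trans (num_queries_liter _ _) _; rewrite ?cards0 // leq_mul2r.
by rewrite ltnW ?orbT.
Qed.

(* The expected gains along the run telescope to at most max f, so a deficit D
   that lower-bounds the gain of a step is small at a uniformly random time. *)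
Lemma Ev_local_search (D : {set 'I_n} -> R) (c M : R) T :
  (0 < T)%N -> 0 < c -> (forall Z, (#|Z| <= k)%N -> f Z <= M) ->
  (forall Z, (#|Z| <= k)%N -> f Z + c * D Z <= Ev f f (lstep Z)) ->
  Ev f D (local_search T) <= M / (c * T%:R).
Proof.
move=> T0 c0 fM step.
have T0' : (0 : R) < T%:R by rewrite ltr0n.
have k_ i := @leaves_liter i set0 ltac:(by rewrite cards0).
have tele i : c * \sum_(0 <= j < i) Ev f D (liter j set0) <= Ev f f (liter i set0).
  elim: i => [|i IH] /=; first by rewrite big_nil mulr0.
  rewrite big_nat_recr //= mulrDr Ev_bind.
  apply: le_trans (_ : Ev f (fun B => f B + c * D B) (liter i set0) <= _).
    by rewrite EvD EvZ lerD2r.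
  exact: ler_Ev (k_ i) step.
rewrite /local_search Ev_unif ?size_iota // /mean size_iota.
have TR : (T%:R : R) != 0 by rewrite lt0r_neq0.
rewrite ler_pdivlMr ?mulr_gt0 // mulrCA mulrAC mulVf // mul1r.
have := tele T; rewrite /index_iota subn0 => /le_trans; apply.
 rewrite -[leRHS](Ev_cst f M (liter T set0)).
exact: ler_Ev (k_ T) fM.
Qed.

End Improvement.
End LocalSearch.

(** * The combined algorithm *)

(** P * v + U * u is regrouped as U * (u + v) + (P - U) * v, so that it matches the two local search
    deficits u + v - 2x and v - x. *)
Lemma mixture_arith (R : realType) (K e P Q U g u v x w px : R) :
  e * (K * (P + U) * x) <= px ->
  K * (e * ((P + Q) * w - P * v - U * u)) <= K * g ->
  K * e * (P + Q) * w - (K * U * e * (u + v - 2 * x) + K * (P - U) * e * (v - x))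
  <= px + K * g.
Proof. lra. Qed.

Lemma deficit_arith (R : realType) (K e P Q U l w d d1 : R) :
  K * U * (e * d) <= K * U * (l * w) ->
  K * (P - U) * (e * d1) <= K * (P - U) * (l * w) ->
  K * P * (l * w) <= l * w ->
  (e * ((P + Q) * K) - l) * w <=
  K * e * (P + Q) * w - (K * U * e * d + K * (P - U) * e * d1).
Proof. lra. Qed.

Lemma split_ratio (R : realType) (x P Q y : R) :
  x <= (1 - 2 * x) * P + (1 - x) * Q + x * y -> 0 < 1 + P + (P + Q - y) ->
  x <= (P + Q) / (1 + P + (P + Q - y)).
Proof. by move=> h den; rewrite ler_pdivlMr //; lra. Qed.

Section Combined.
Variables (R : realType) (n k t L : nat).
Hypotheses (k0 : (0 < k)%N) (kn : (k <= n)%N) (t2 : (2 <= t)%N) (L0 : (0 < L)%N).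
Variable a : nat.
Hypothesis ak : (a <= k)%N.

Let q : R := 1 - k%:R^-1.
Let P : R := q ^+ a - q ^+ k.
Let Q : R := a%:R / k%:R * q ^+ a.-1.
Let U : R := P + Q - q ^+ k.-1.

(* Chosen so that the coefficient of f Z in the guarantee of the mixture
   vanishes in the worst case f (Z :&: OPT) = f (Z :|: OPT) = f Z. *)
Definition pmix : R := (P + U) / (1 + P + U).

Definition greedy (Z : {set 'I_n}) : oalg R n :=
  bind (giter R k t Z (k - a) set0) (giter R k t set0 a).

Definition mixed : oalg R n :=
  bind (local_search R n k t (L * k))
    (fun Z => Flip pmix (fun b => if b then Ret R Z else greedy Z)).

Let kR : (0 : R) < k%:R. Proof. by rewrite ltr0n. Qed.
Let q0 : 0 <= q. Proof. by rewrite subr_ge0 invf_le1 // ler1n. Qed.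
Let q1 : q <= 1. Proof. by rewrite gerBl invr_ge0 ler0n. Qed.

Let e01 : 0 <= (k%:R^-1 : R) <= 1.
Proof. by rewrite invr_ge0 ler0n invf_le1 // ler1n. Qed.

Lemma exprn_onem_ub (e : R) j : 0 <= e <= 1 ->
  (1 - e) ^+ j <= 1 - j%:R * e + j%:R * (j%:R - 1) / 2 * e ^+ 2.
Proof.
move=> /andP[e0 e1]; elim: j => [|j IH]; first by rewrite expr0 !mul0r subr0 addr0.
have := @ler_wpM2l R (1 - e) _ _ _ IH; rewrite subr_ge0 => /(_ e1).
have : 0 <= j%:R * (j%:R - 1) * e ^+ 3.
  rewrite mulr_ge0 ?exprn_ge0 //; case: (j) => [|i]; first by rewrite mul0r.
  by rewrite -natr1 addrK mulr_ge0 ?addr_ge0 ?ler0n.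
rewrite [_ ^+ j.+1]exprS -[j.+1%:R]natr1; set x : R := j%:R => h /le_trans; apply.
rewrite -subr_ge0 (_ : _ - _ = x * (x - 1) * e ^+ 3 / 2); last by field.
by rewrite divr_ge0.
Qed.

(** Bernoulli's inequality gives a/k <= q^(k-a). The bound amounts to U <= P, so the second deficit
    has a nonnegative weight. *)
Lemma Q_le : Q <= q ^+ k.-1.
Proof.
rewrite /Q; case: a ak => [|b] bk; first by rewrite !mul0r exprn_ge0.
have -> : (k.-1 = k - b.+1 + b)%N by rewrite addnC -{1}(subnKC bk).
rewrite exprD /= ler_wpM2r ?exprn_ge0 //.
have := exprn_onem_lb (k - b.+1) e01.
by rewrite -/q natrB // mulrBl divff ?lt0r_neq0 // opprB addrCA subrr addr0.
Qed.

Lemma exprn_onem_sum (e : R) s : 0 <= e <= 1 -> s%:R * e <= 1 ->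
  (1 - e) ^+ s + (1 - e) ^+ s.+1 <= 2 - (s%:R + 1) * e.
Proof.
move=> h01 se; have := exprn_onem_ub s h01; have := exprn_onem_ub s.+1 h01.
have s0 : 0 <= s%:R * e by rewrite mulr_ge0 ?ler0n //; case/andP: h01.
rewrite -[s.+1%:R]natr1; move: ((1 - e) ^+ s) ((1 - e) ^+ s.+1) => x y.
move: (s%:R) se s0 => z; nra.
Qed.

(** For a > 0, dividing by q^(a-1) leaves q^s + q^(s+1) <= q + a/k with s = k - a, and the right
    side is exactly 2 - (s+1)/k. *)
Lemma U_ge0 : 0 <= U.
Proof.
rewrite /U /P /Q subr_ge0.
have h s : (s <= k)%N -> q ^+ s + q ^+ s.+1 <= 2 - (s%:R + 1) / k%:R.
  by move=> sk; apply: exprn_onem_sum => //; rewrite ler_pdivrMr // mul1r ler_nat.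
case: a ak => [|b] bk.
  rewrite !mul0r addr0 expr0 lerBrDr.
  have := h k.-1 (leq_pred k); rewrite natr1 prednK // divff ?lt0r_neq0 //; lra.
have sE : ((k - b.+1)%:R / k%:R : R) = 1 - b.+1%:R / k%:R.
  by rewrite natrB // mulrBl divff ?lt0r_neq0.
have -> : q ^+ k.-1 = q ^+ b * q ^+ (k - b.+1) by rewrite -exprD -{1}(subnKC bk).
have -> : q ^+ k = q ^+ b * q ^+ (k - b.+1).+1 by rewrite -exprD addnS -addSn subnKC.
rewrite exprSr /= -subr_ge0.
set x := q ^+ (k - b.+1); set y := q ^+ _.+1.
have -> : q ^+ b * q - q ^+ b * y + b.+1%:R / k%:R * q ^+ b - q ^+ b * x =
   q ^+ b * (q + b.+1%:R / k%:R - (x + y)) by ring.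
rewrite mulr_ge0 ?exprn_ge0 // subr_ge0; apply: le_trans (h _ (leq_subr _ _)) _.
by rewrite mulrDl sE /q mul1r; lra.
Qed.

Lemma P_ge0 : 0 <= P.
Proof. by rewrite subr_ge0 ler_wiXn2l. Qed.

Lemma P_le1 : P <= 1.
Proof.
by rewrite lerBlDr (le_trans (exprn_ile1 _ _ _)) // lerDl exprn_ge0.
Qed.

Section Guarantee.
Variable f : {set 'I_n} -> R.
Hypotheses (f0 : nonnegative f) (sf : submodular f).

Lemma leaves_greedy (Z : {set 'I_n}) : (#|Z| <= k)%N ->
  leaves f (fun B => (#|B| <= k)%N : Prop) (greedy Z).
Proof.
move=> Zk; apply: leaves_bind.
apply: leaves_impl (giter_card k t f Z (k - a) set0) => B Bk.
apply: leaves_impl (giter_card k t f set0 a B) => C Ck.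
by move: Bk Ck; rewrite cards0; lia.
Qed.

Lemma leaves_mixed : leaves f (fun B => (#|B| <= k)%N : Prop) mixed.
Proof.
apply: leaves_bind.
apply: leaves_impl (leaves_local_search k t f (L * k)) => Z Zk /=.
by split=> //; apply: leaves_greedy.
Qed.

Lemma num_queries_mixed :
  (num_queries f mixed <= L.+1 * (t ^ 2 + 2) * (n + k ^ 2))%N.
Proof.
have gq Z : (num_queries f (greedy Z) <= k * (rate n k t).+1)%N.
  apply: leq_trans (_ : _ <= num_queries f (giter R k t Z (k - a) set0) +
      a * (rate n k t).+1)%N _.
    apply: num_queries_bind; apply: leaves_impl (leaves_true f _) => B _.
    exact: num_queries_giter.
  apply: (leq_trans (leq_add (num_queries_giter _ _ _ _ _ _) (leqnn _))).
  by rewrite -mulnDl subnK.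
apply: leq_trans (_ : _ <= num_queries f (local_search R n k t (L * k)) +
    k * (rate n k t).+1)%N _.
  apply: num_queries_bind; apply: leaves_impl (leaves_true f _) => Z _ /=.
  by rewrite max0n.
apply: (leq_trans (leq_add (num_queries_local_search k t f _) (leqnn _))).
have : (rate n k t * k <= t ^ 2 * n)%N by apply: leq_divM.
move: (rate n k t) (t ^ 2)%N => r T h.
have kk : (k <= k ^ 2)%N by rewrite -[X in (X <= _)%N]expn1 leq_pexp2l.
apply: (@leq_trans (L.+1 * (T * n + 2 * k ^ 2))%N).
  have -> : (L * k * (r + k).+1 + k * r.+1 =
      L * (r * k + k ^ 2 + k) + (r * k + k))%N by ring.
  have -> : (L.+1 * (T * n + 2 * k ^ 2) =
      L * (T * n + k ^ 2 + k ^ 2) + (T * n + 2 * k ^ 2))%N by ring.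
  apply: leq_add; first by rewrite leq_mul2l !leq_add ?orbT.
  by apply: leq_add h _; apply: leq_trans kk _; apply: leq_pmull.
rewrite -mulnA leq_mul2l mulnDl; apply/orP; right.
by apply: leq_add; rewrite leq_mul2l ?leq_addr ?leq_addl orbT.
Qed.

Let PU0 : 0 <= P + U. Proof. exact: addr_ge0 P_ge0 U_ge0. Qed.

Let denE : 1 + P + U = 1 + (P + U). Proof. by rewrite -[1 + P + U]addrA. Qed.

Let den_ge1 : 1 <= 1 + P + U. Proof. by rewrite denE lerDl. Qed.

Let den_gt0 : 0 < 1 + P + U. Proof. exact: lt_le_trans den_ge1. Qed.

Lemma pmix_itv : 0 <= pmix <= 1.
Proof.
rewrite /pmix (divr_ge0 PU0 (ltW den_gt0)) /=.
by rewrite ler_pdivrMr // mul1r denE lerDr.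
Qed.

Lemma onem_pmix : 1 - pmix = (1 + P + U)^-1.
Proof.
have den0 := lt0r_neq0 den_gt0; rewrite /pmix -[X in X - _](divff den0) -mulrBl.
by rewrite {1}denE addrK div1r.
Qed.

Lemma Ev_mixed (O : {set 'I_n}) : (#|O| <= k)%N ->
  (forall T : {set 'I_n}, (#|T| <= k)%N -> f T <= f O) ->
  ((1 - t%:R^-1) * ((P + Q) / (1 + P + U)) - 2 / L%:R) * f O <= Ev f f mixed.
Proof.
move=> Ok Omax; rewrite /mixed Ev_bind.
set K := (1 + P + U)^-1; pose eps : R := t%:R^-1.
have K0 : 0 <= K by rewrite invr_ge0 ltW.
have K1 : K <= 1 by rewrite invf_le1.
have tR : (0 : R) < t%:R by rewrite ltr0n ltnW.
have LR : (0 : R) < L%:R by rewrite ltr0n.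
have eps0 : 0 < 1 - eps by rewrite subr_gt0 invf_lt1 // ltr1n.
have eps1 : 1 - eps <= 1 by rewrite gerBl invr_ge0 ler0n.
pose D Z := f (Z :|: O) + f (Z :&: O) - 2 * f Z.
pose D1 Z := f (Z :&: O) - f Z.
pose c := (1 - eps) / (2 * k%:R).
have c0 : 0 < c by rewrite divr_gt0 ?mulr_gt0.
have T0 : (0 < L * k)%N by rewrite muln_gt0 L0.
have M E : Ev f E (local_search R n k t (L * k)) <= f O / (c * (L * k)%:R) ->
    (1 - eps) * Ev f E (local_search R n k t (L * k)) <= 2 / L%:R * f O.
  move=> h; have := ler_wpM2l (ltW eps0) h; move/le_trans; apply.
  rewrite le_eqVlt; apply/orP; left; apply/eqP; rewrite /c natrM.
  by move: (1 - eps) eps0 => e e0; field; rewrite !lt0r_neq0.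
have ED := M _ (Ev_local_search f0 T0 c0 Omax
  (fun Z Zk => lstep_union_inter k0 kn t2 sf Zk Ok)).
have ED1 := M _ (Ev_local_search f0 T0 c0 Omax
  (fun Z Zk => lstep_inter k0 kn t2 sf O Zk)).
(* For each fixed [Z] the mixture is bounded by a constant minus weighted deficits; the deficits are
   averaged over the local search afterwards. *)
apply: (@le_trans _ _ (Ev f (fun Z => K * (1 - eps) * (P + Q) * f O -
   (K * U * (1 - eps) * D Z + K * (P - U) * (1 - eps) * D1 Z))
   (local_search R n k t (L * k)))); last first.
  apply: ler_Ev (leaves_true f _) _ => Z _ /=.
  rewrite clamp01_id ?pmix_itv // onem_pmix -/K.
  have := @greedy_value R n k t k0 kn t2 f f0 sf Z O (k - a) P Q Ok (leq_subr _ _).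
  rewrite subKn // => /(_ erefl erefl) /(ler_wpM2l K0).
  rewrite -/U -/(greedy Z) -/eps.
  have : (1 - eps) * (K * (P + U) * f Z) <= pmix * f Z.
    rewrite /pmix [_ / _]mulrC -/K ler_piMl //.
    by rewrite mulr_ge0 ?f0 // (mulr_ge0 K0 PU0).
  exact: mixture_arith.
rewrite EvB Ev_cst EvD !EvZ.
set ed := Ev f D _ in ED *; set ed1 := Ev f D1 _ in ED1 *.
have PU : 0 <= P - U.
  by rewrite (_ : P - U = q ^+ k.-1 - Q) ?subr_ge0 ?Q_le //; rewrite /U; ring.
have h1 := ler_wpM2l (mulr_ge0 K0 U_ge0) ED.
have h2 := ler_wpM2l (mulr_ge0 K0 PU) ED1.
have h3 : K * P * (2 / L%:R * f O) <= 2 / L%:R * f O.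
  rewrite ler_piMl ?mulr_ge0 ?invr_ge0 ?ler0n //.
  by rewrite mulr_ile1 ?P_ge0 ?P_le1.
exact: deficit_arith h1 h2 h3.
Qed.

End Guarantee.
End Combined.

Lemma mixed_alg_exists (R : realType) : exists C : nat,
  forall n k : nat, (0 < k)%N -> (k <= n)%N -> exists alg : oalg R n,
    forall f : {set 'I_n} -> R, nonnegative f -> submodular f ->
      [/\ outputs_size_le f k alg,
          (num_queries f alg <= C * (n + k ^ 2))%N &
          forall OPT : {set 'I_n}, (#|OPT| <= k)%N ->
            (forall T : {set 'I_n}, (#|T| <= k)%N -> f T <= f OPT) ->
            expected_value f alg >= (385%:R / 1000%:R) * f OPT].
Proof.
(* [N] serves as both [t] and [L]. The loss 131/340/N + 2/N is about 0.00024, below the slack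
   131/340 - 0.385 of about 0.00029. *)
pose N := (100 ^ 2)%N.
have N0 : (0 < N)%N by rewrite expn_gt0.
have N2 : (2 <= N)%N by [].
have NE : (N%:R : R) = 100 * 100 by rewrite natrX expr2.
clearbody N; exists (N.+1 * (N ^ 2 + 2))%N => n k k0 kn.
pose q : R := 1 - k%:R^-1.
have [a ak split] := split_exists (R := R) k0 (erefl q).
exists (mixed R n k N N a) => f f0 sf; split.
- by rewrite outputs_size_leE; apply: leaves_mixed.
- exact: num_queries_mixed.
move=> O Ok Omax; rewrite expected_valueE.
apply: le_trans (Ev_mixed k0 kn N2 N0 ak f0 sf Ok Omax).
rewrite ler_wpM2r ?f0 //.
have P0 := P_ge0 R k0 ak; have U0 := U_ge0 R k0 ak.
move: split P0 U0; rewrite -/q; set P := q ^+ a - q ^+ k.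
set Q := a%:R / k%:R * q ^+ a.-1; set y := q ^+ k.-1; set U := P + Q - y.
move=> split P0 U0.
have h : 131 / 340 <= (P + Q) / (1 + P + U).
  by apply: split_ratio split _; rewrite -/U; lra.
rewrite NE; move: ((P + Q) / _) h => z; clear.
have -> : (100 * 100 : R)^-1 = 1 / 100 / 100 by field.
lra.
Qed.

Theorem mainTheorem1 (R : realType) :
  exists (C : nat) (alg : forall n k : nat, oalg R n),
    forall (n k : nat), (0 < k)%N ->
    forall f : {set 'I_n} -> R, nonnegative f -> submodular f ->
      [/\ outputs_size_le f k (alg n k),
          (num_queries f (alg n k) <= C * (n + k ^ 2))%N &
          forall OPT : {set 'I_n}, (#|OPT| <= k)%N ->
            (forall T : {set 'I_n}, (#|T| <= k)%N -> f T <= f OPT) ->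
            expected_value f (alg n k) >= (385%:R / 1000%:R) * f OPT].
Proof.
have [C HC] := mixed_alg_exists R; exists C.
suff alg_ex n k : exists alg : oalg R n, (0 < k)%N ->
    forall f : {set 'I_n} -> R, nonnegative f -> submodular f ->
      [/\ outputs_size_le f k alg,
          (num_queries f alg <= C * (n + k ^ 2))%N &
          forall OPT : {set 'I_n}, (#|OPT| <= k)%N ->
            (forall T : {set 'I_n}, (#|T| <= k)%N -> f T <= f OPT) ->
            expected_value f alg >= (385%:R / 1000%:R) * f OPT].
  (* The algorithm depends on [n] and [k] only, since the choice is made before [f] is given. *)
  exists (fun n k => projT1 (cid (alg_ex n k))) => n k.
  exact: projT2 (cid (alg_ex n k)).
have [->|k0] := posnP k; first by exists (Ret R set0).
have c1 : (385 / 1000 : R) <= 1 by lra.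
have [n0|n0] := posnP n.
  exists (Ret R set0) => _ f f0 sf; split=> //=; first by rewrite cards0.
  move=> O _ _; have -> : O = set0.
    by apply/setP => x; have := leq_trans (ltn_ord x) (eq_leq n0).
  by rewrite ler_piMl ?f0.
(* For k > n the algorithm for cardinality bound [n] is used, as every set has at most [n]
   elements. *)
have m0 : (0 < minn k n)%N by rewrite leq_min k0.
have [alg Halg] := HC n _ m0 (geq_minr k n).
exists alg => _ f f0 sf; have [sz nq opt] := Halg f f0 sf; split.
- rewrite !outputs_size_leE in sz *; apply: leaves_impl sz => X.
  by rewrite leq_min => /andP[].
- apply: leq_trans nq _; rewrite leq_mul2l leq_add2l leq_exp2r // geq_minl.
  by rewrite orbT.
move=> O Ok Omax; apply: opt.
  by rewrite leq_min Ok -[X in (_ <= X)%N]card_ord max_card.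
by move=> T; rewrite leq_min => /andP[Tk _]; apply: Omax.
Qed.
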